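(* Assume conditions (H1), (H3), (H4) hold, and let $0<\tau<1$. There exist an open interval $J\subset I$ centered at $0$ and maps $\lambda(\cdot):J\to\mathbb C$, $v(\cdot):J\to\mathcal B$, $\phi(\cdot):J\to\mathcal B'$, $N(\cdot):J\to\mathcal L(\mathcal B)$ such that for all $t\in J$, $n\ge1$, $f\in\mathcal B$, $$Q(t)^nf=\lambda(t)^n\langle\phi(t),f\rangle v(t)+N(t)^nf,$$ and moreover: (a) $\langle\phi(t),v(t)\rangle=1$, $\phi(t)\circ N(t)=0$, $N(t)v(t)=0$, $Q(t)v(t)=\lambda(t)v(t)$, and $\lambda(t)\to1$ as $t\to0$; (b) $\nu(v(t))=1$, and there exist $C>0$ and $\rho<1$ such that for all $t\in J$ and $n\ge1$: (b1) $\nu(|v(t)-\mathbf 1|)\le C|t|^\tau$; (b2) $|\langle\phi(t),\mathbf 1\rangle-1|\le C|t|^\tau$; (b3) $\nu(|N(t)^n\mathbf 1|)\le C\rho^n|t|^\tau$; (c) $\lambda(\cdot)$ is continuous on $J$.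
   Context: $(E,\mathcal E)$ measurable space, $Q$ a transition probability with invariant probability $\nu$, $\xi:E\to\mathbb R$ measurable and $\nu$-integrable with $\nu(\xi)=0$, $\mathbf 1$ the constant function 1, and $Q(t)f(x)=\int e^{it\xi(y)}f(y)Q(x,dy)$. $(\mathcal B,\|\cdot\|)$ is a Banach space of measurable complex functions on $E$, $\mathcal B'$ its topological dual with pairing $\langle\cdot,\cdot\rangle$, $\mathcal L(\mathcal B)$ the bounded operators on $\mathcal B$. (H1): $Q$ is $\mathcal B$-geometrically ergodic, i.e. $\mathbf 1\in\mathcal B$, $\mathcal B$ embeds continuously in $L^1(\nu)$, $Q\in\mathcal L(\mathcal B)$, and $\|Q^nf-\nu(f)\mathbf 1\|\le C\kappa_0^n\|f\|$ for some $\kappa_0<1$, $C\ge0$, all $n\ge1$, $f\in\mathcal B$. (H3): $\sup\{\nu(|e^{it\xi}-1||f|): f\in\mathcal B,\|f\|\le1\}=O(|t|)$ as $t\to0$. (H4): there is an open interval $I\ni0$ such that for $t\in I$, $Q(t)\in\mathcal L(\mathcal B)$, there are $\kappa<1$, $C\ge0$ with $\|Q(t)^nf\|\le C\kappa^n\|f\|+C\nu(|f|)$ for all $n\ge1$, $t\in I$, $f\in\mathcal B$, and the essential spectral radius of $Q(t)$ on $\mathcal B$ is $\le\kappa$. *)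

(* Defs.v *)
From HB Require Import structures.
From mathcomp Require Import all_boot all_order all_algebra.
From mathcomp Require Import all_classical all_reals all_analysis.
From mathcomp Require Import complex.
Set Implicit Arguments. Unset Strict Implicit. Unset Printing Implicit Defensive.
Import Order.TTheory GRing.Theory Num.Theory.
Local Open Scope classical_set_scope.
Local Open Scope ring_scope.

Section Defs.
Variables (R : realType) (d : measure_display) (E : measurableType d).
Local Notation C := R[i].
Local Notation fn := (E -> C).

Definition cabs (z : C) : R := Num.sqrt (complex.Re z ^+ 2 + complex.Im z ^+ 2).

Definition one_fn : fn := fun _ => 1.

Definition expi (s : R) : C := Complex (cos s) (sin s).

Definition cmeasurable (f : fn) : Prop :=
  measurable_fun setT (fun x => complex.Re (f x)) /\
  measurable_fun setT (fun x => complex.Im (f x)).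

Definition cintegrable (mu : {measure set E -> \bar R}) (f : fn) : Prop :=
  cmeasurable f /\ mu.-integrable setT (fun x => (cabs (f x))%:E).

Definition cint (mu : {measure set E -> \bar R}) (f : fn) : C :=
  Complex (\int[mu]_x (complex.Re (f x)))%R (\int[mu]_x (complex.Im (f x)))%R.

Definition absint (mu : {measure set E -> \bar R}) (f : fn) : \bar R :=
  (\int[mu]_x (cabs (f x))%:E)%E.

Definition Qt (Q : R.-pker E ~> E) (xi : E -> R) (t : R) (f : fn) : fn :=
  fun x => cint (Q x) (fun y => expi (t * xi y) * f y).

Definition banach_fun_space (B : set fn) (nrm : fn -> R) : Prop :=
  [/\ B (fun _ => 0) /\ (forall f g, B f -> B g -> B (fun x => f x + g x)),
      (forall (c : C) f, B f -> B (fun x => c * f x)),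
      (forall f, B f -> cmeasurable f),
      [/\ (forall f, B f -> 0 <= nrm f),
          (forall f, B f -> nrm f = 0 -> f = (fun _ => 0)),
          (forall (c : C) f, B f -> nrm (fun x => c * f x) = cabs c * nrm f) &
          (forall f g, B f -> B g -> nrm (fun x => f x + g x) <= nrm f + nrm g)] &
      (forall u : nat -> fn, (forall n, B (u n)) ->
        (forall e : R, 0 < e -> exists N, forall m n, (N <= m)%N -> (N <= n)%N ->
           nrm (fun x => u m x - u n x) < e) ->
        exists l, B l /\ forall e : R, 0 < e -> exists N, forall n, (N <= n)%N ->
           nrm (fun x => u n x - l x) < e)].

Definition bounded_op (B : set fn) (nrm : fn -> R) (T : fn -> fn) : Prop :=
  [/\ (forall f, B f -> B (T f)),
      (forall f g, B f -> B g -> T (fun x => f x + g x) = (fun x => T f x + T g x)),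
      (forall (c : C) f, B f -> T (fun x => c * f x) = (fun x => c * T f x)) &
      exists c : R, forall f, B f -> nrm (T f) <= c * nrm f].

Definition dual_elt (B : set fn) (nrm : fn -> R) (phi : fn -> C) : Prop :=
  [/\ (forall f g, B f -> B g -> phi (fun x => f x + g x) = phi f + phi g),
      (forall (c : C) f, B f -> phi (fun x => c * f x) = c * phi f) &
      exists c : R, forall f, B f -> cabs (phi f) <= c * nrm f].

Definition opnorm (B : set fn) (nrm : fn -> R) (T : fn -> fn) : R :=
  sup [set nrm (T f) | f in [set f | B f /\ nrm f <= 1]].

(* compact operator: bounded, and the image of the unit ball is relatively
   compact, i.e. (B being complete) totally bounded *)
Definition compact_op (B : set fn) (nrm : fn -> R) (K : fn -> fn) : Prop :=
  bounded_op B nrm K /\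
  forall e : R, 0 < e -> exists s : seq fn, (forall g, g \in s -> B g) /\
    forall f, B f -> nrm f <= 1 ->
      exists2 g, g \in s & nrm (fun x => K f x - g x) < e.

Definition essnorm (B : set fn) (nrm : fn -> R) (T : fn -> fn) : R :=
  inf [set opnorm B nrm (fun f x => T f x - K f x) | K in compact_op B nrm].

(* essential spectral radius: spectral radius in the Calkin algebra,
   r_ess(T) = lim_n essnorm(T^n)^(1/n) = inf_{n>=1} essnorm(T^n)^(1/n) *)
Definition ess_spectral_radius (B : set fn) (nrm : fn -> R) (T : fn -> fn) : R :=
  inf [set (essnorm B nrm (iter n T)) `^ (n%:R)^-1 | n in [set n : nat | (0 < n)%N]].

End Defs.

Definition Qop (R : realType) (d : measure_display) (E : measurableType d)
  (Q : R.-pker E ~> E) (f : E -> R[i]) : E -> R[i] :=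
  fun x => cint (Q x) f.
Arguments one_fn {R d E}.

(* Main.v *)
Require Import Defs.
From HB Require Import structures.
From mathcomp Require Import all_boot all_order all_algebra.
From mathcomp Require Import all_classical all_reals all_analysis.
From mathcomp Require Import measurable_realfun complex ring lra.
Set Implicit Arguments. Unset Strict Implicit. Unset Printing Implicit Defensive.
Import Order.TTheory GRing.Theory Num.Theory.
Import numFieldNormedType.Exports.
Local Open Scope classical_set_scope.
Local Open Scope ring_scope.

(* Combining geometric ergodicity of Q, the Doeblin-Fortet inequality for Q(t)
   and the estimate nu|(Q(t) - Q(s))f| <= c|t - s| ||f||, some power T = Q(t)^p
   contracts the hyperplane ker nu in the strong norm, uniformly for t near 0,
   while nu(T f) = nu(f) + O(|t| ||f||). Hence f |-> T f / nu(T f) has a fixed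
   point v(t) among the f with nu(f) = 1; it spans the only eigenline of T
   transversal to ker nu, so it is an eigenvector of Q(t). The coordinate phi(t)
   along v(t) is the limit of mu^-n nu(T^n f), where T v(t) = mu v(t). No spectral
   theory is needed, and the bound on the essential spectral radius only serves to
   see that kappa >= 0.
   The weak norm of v(t) - 1 and the increments of lambda are both bounded by
   C r^-n (n s + kappa^n) for every n, with r < 1 as close to 1 as desired and s
   the size of the perturbation; optimizing in n gives s^sigma for any sigma < 1.
   Bound (b3) interpolates between a weak bound C|t|^sigma and a strong bound
   C rho^n. *)

(** The obstacle is that [t |-> Q(t)] need not be continuous for the operator norm of the Banach
    space: (H3) measures [Q(t) - Q(s)] only from the strong norm to the weak norm [nu|f|]. Since nu
    is invariant and characters have modulus 1, [Q(t)] does not increase the weak norm, so errors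
    add up linearly over n steps: this is the term [n s]. The Doeblin-Fortet inequality turns weak
    smallness into strong smallness up to [kappa^n]. And [|e^(it xi) - e^(is xi)| = |e^(i(t-s) xi) -
    1|], so the estimate (H3) at 0 holds between any two parameters, which gives continuity of
    lambda on all of J. The factor [r^-n] comes from dividing by [lambda(t)^n]: J is shrunk until
    [|lambda| >= r]. Dividing by nu is the right normalization because nu is the left eigenvector of
    Q. The exponent sigma is taken strictly above tau, because the interpolation for (b3) multiplies
    it by some theta < 1. *)

Section ComplexModulus.
Variable R : realType.
Implicit Types x y z : R[i].

Lemma cabsE z : cabs z = Normc.normc z.
Proof. by case: z. Qed.

Lemma cabs_ge0 z : 0 <= cabs z.
Proof. exact: sqrtr_ge0. Qed.

Lemma cabs0 : cabs (0 : R[i]) = 0.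
Proof. by rewrite cabsE Normc.normc0. Qed.

Lemma cabs1 : cabs (1 : R[i]) = 1.
Proof. by rewrite cabsE Normc.normc1. Qed.

Lemma cabs_eq0 z : cabs z = 0 -> z = 0.
Proof. by rewrite cabsE => /Normc.eq0_normc. Qed.

Lemma cabsM x y : cabs (x * y) = cabs x * cabs y.
Proof. by rewrite !cabsE Normc.normcM. Qed.

Lemma cabsV x : cabs x^-1 = (cabs x)^-1.
Proof. by rewrite !cabsE Normc.normcV. Qed.

Lemma cabsX x n : cabs (x ^+ n) = cabs x ^+ n.
Proof. by elim: n => [|n IH]; rewrite ?expr0 ?cabs1// !exprS cabsM IH. Qed.

Lemma cabsN x : cabs (- x) = cabs x.
Proof. by rewrite !cabsE normcN. Qed.

Lemma cabsB x y : cabs (x - y) = cabs (y - x).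
Proof. by rewrite -cabsN opprB. Qed.

Lemma cabsD x y : cabs (x + y) <= cabs x + cabs y.
Proof. by rewrite !cabsE le_normcD. Qed.

Lemma cabs_leB x y : cabs x <= cabs y + cabs (x - y).
Proof. by rewrite -{1}(subrKC y x) cabsD. Qed.

Lemma cabs_subV x y : x != 0 -> y != 0 ->
  cabs (x^-1 - y^-1) = cabs (x - y) / (cabs x * cabs y).
Proof.
move=> x0 y0; rewrite -cabsM -cabsV -cabsM [RHS]cabsE -normcN -cabsE.
by congr cabs; field; rewrite x0 y0.
Qed.

End ComplexModulus.

(** * Geometric sequences, and trading the number of iterations against the size of the
    perturbation *)

Section GeometricRates.
Variable R : realType.
Implicit Types q r s x M c e : R.

Lemma geometric_small q c e : 0 <= q < 1 -> 0 < e ->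
  exists N, forall n, (N <= n)%N -> c * q ^+ n < e.
Proof.
move=> /andP[q0 q1] e0.
have /cvg_expr H : `|q| < 1 by rewrite ger0_norm.
have : (fun n => c * q ^+ n) @ \oo --> (c * 0 : R) by exact: cvgMr.
rewrite mulr0 => /cvgrPdist_lt/(_ _ e0)[N _ HN].
exists N => n Nn; have := HN n Nn; rewrite /= sub0r normrN.
by apply: le_lt_trans; exact: ler_norm.
Qed.

Lemma le0_geometric q c x : 0 <= q < 1 ->
  (forall n, x <= c * q ^+ n) -> x <= 0.
Proof.
move=> q01 H; rewrite leNgt; apply/negP => x0.
have [N /(_ N (leqnn _))] := geometric_small c q01 x0.
by rewrite ltNge H.
Qed.

Lemma exists_root_lt1 q p : 0 < q < 1 -> (0 < p)%N ->
  exists2 r, 0 < r < 1 & r ^+ p = q.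
Proof.
move=> /andP[q0 q1] p0; pose r := q `^ p%:R^-1.
have rp : r ^+ p = q.
  by rewrite -powR_mulrn ?powR_ge0// -powRrM mulVf ?powRr1 ?pnatr_eq0 -?lt0n ?ltW.
exists r => //; rewrite powR_gt0//=.
have [//|r1] := ltP r 1.
by move: q1; rewrite -rp ltNge exprn_ege1.
Qed.

(** Each of the n terms of [1 + r + ... + r^(n-1) = (1 - r^n) / (1 - r)] is at least [r^n]. *)
Lemma natr_mul_expr_le r n : 0 <= r < 1 -> n%:R * r ^+ n <= (1 - r)^-1.
Proof.
move=> /andP[r0 r1].
have H : n%:R * r ^+ n * (1 - r) <= 1 - r ^+ n.
  elim: n => [|n IH]; first by rewrite mul0r mul0r expr0 subrr.
  have y1 : r ^+ n <= 1 by rewrite exprn_ile1// ltW.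
  rewrite exprS -natr1; move: (r ^+ n) (n%:R : R) y1 IH => y N y1 IH.
  have := ler_wpM2l r0 IH.
  have : 0 <= (1 - r) * (1 - r * y) by apply: mulr_ge0; nra.
  lra.
rewrite -[leRHS]mul1r ler_pdivlMr ?subr_gt0//; apply: le_trans H _.
by rewrite gerBl exprn_ge0.
Qed.

Lemma powR_exprn x y n : 0 <= x -> (x ^+ n) `^ y = (x `^ y) ^+ n.
Proof.
move=> x0; elim: n => [|n IH]; first by rewrite !expr0 powR1.
by rewrite !exprS powRM ?exprn_ge0// IH.
Qed.

Lemma exists_common_bound (s : seq R) : exists2 C, 1 <= C & forall i, s`_i <= C.
Proof.
elim: s => [|x s [C C1 HC]]; first by exists 1 => // i; rewrite nth_nil.
exists (Num.max x C) => [|[|i]] /=; first by rewrite le_max C1 orbT.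
  by rewrite le_max lexx.
by rewrite le_max HC orbT.
Qed.

(* The free parameter n is chosen with theta ^ n comparable to s, where
   kappa < theta < 1; the loss r ^ - n is then a small negative power of s. *)
Lemma optimize_rate (kappa sigma : R) : 0 <= kappa < 1 -> 0 < sigma < 1 ->
  exists r K : R, [/\ kappa < r < 1, 0 < K &
    forall s x M, 0 <= M -> 0 <= s < 1 ->
      (forall n, (0 < n)%N -> x <= M * (r ^- n * (n%:R * s + kappa ^+ n))) ->
      x <= M * K * s `^ sigma].
Proof.
move=> /andP[k0 k1] /andP[sg0 sg1].
(* [e] is half of [1 - sigma] because the loss [r^-n] occurs twice: once in the hypothesis, once
   when the factor [n] is absorbed through [n <= (1 - r)^-1 r^-n]. *)
pose th := (1 + kappa) / 2; pose e : R := (1 - sigma) / 2; pose r : R := th `^ e.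
have th01 : 0 < th <= 1 by rewrite /th; apply/andP; split; lra.
have th0 : 0 < th by case/andP: th01.
have kth : kappa < th by rewrite /th; lra.
have r0 : 0 < r by rewrite powR_gt0.
have kr : kappa < r.
  by apply: lt_le_trans kth _; apply: ger1_powR => //; rewrite /e; lra.
have r1 : r < 1.
  have <- : 1 `^ e = 1 :> R by rewrite powR1.
  apply: gt0_ltr_powR; rewrite ?nnegrE ?ltW//; rewrite /e/th; lra.
(* The exponent used is one step past the last power of [th] that is at least [s], so each of the
   two losses is at most [(r s^e)^-1]; hence [r ^+ 2]. *)
exists r, (2 / ((1 - r) * r ^+ 2)); split; first by rewrite kr.
  by rewrite divr_gt0// mulr_gt0 ?subr_gt0 ?exprn_gt0.
move=> s x M M0 /andP[s0 s1] H.
(* For [s = 0] the claim is [x <= 0], which follows from [x <= M (kappa / r)^n] for all n. The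
   hypothesis starts at 1; its instance at 1 also gives the bound at 0, as [kappa < r]. *)
move: s0; rewrite le_eqVlt => /predU1P[s0|s0].
  rewrite -s0 powR0 ?lt0r_neq0// mulr0.
  apply: (@le0_geometric (kappa / r) M).
    by apply/andP; split; [exact: divr_ge0 k0 (ltW r0)|rewrite ltr_pdivrMr// mul1r].
  case=> [|n].
    have := H 1%N isT; rewrite -s0 mulr0 add0r expr0 mulr1 => /le_trans; apply.
    by rewrite -{2}[M]mulr1 ler_wpM2l// mulrC ler_pdivrMr// mul1r expr1 ltW.
  by have := H n.+1 isT; rewrite -s0 mulr0 add0r expr_div_n [_ * kappa ^+ _]mulrC.
have [N HN] : exists n, th ^+ n <= s.
  have th1 : 0 <= th < 1 by rewrite (ltW th0)/= /th; lra.
  have [N HN] := @geometric_small th 1 s th1 s0.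
  by exists N; apply: ltW; rewrite -[ltLHS]mul1r HN.
have exN : exists n, th ^+ n <= s by exists N.
case: (ex_minnP exN) => {N HN} -[|n] Hn minn; first by move: Hn; rewrite expr0; lra.
have thn : s <= th ^+ n.
  by rewrite leNgt; apply/negP => /ltW /minn; rewrite ltnn.
have rE m : r ^+ m = (th ^+ m) `^ e.
  by rewrite powR_exprn// ltW.
have rs : r * s `^ e <= r ^+ n.+1.
  have e0 : 0 <= e by rewrite /e; lra.
  rewrite exprS ler_pM2l// rE; apply: ge0_ler_powR => //; rewrite nnegrE.
    exact: ltW.
  by rewrite exprn_ge0// ltW.
have se0 : 0 < s `^ e by rewrite powR_gt0.
have rV : r ^- n.+1 <= (r * s `^ e)^-1.
  by rewrite lef_pV2 ?posrE//; [exact: exprn_gt0|exact: mulr_gt0].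
apply: le_trans (H n.+1 isT) _; rewrite -mulrA ler_wpM2l//.
have nr : n.+1%:R <= (1 - r)^-1 * r ^- n.+1.
  by rewrite ler_pdivlMr ?exprn_gt0// natr_mul_expr_le// ltW.
have kn : kappa ^+ n.+1 <= s.
  by apply: le_trans Hn; apply: lerXn2r; rewrite ?nnegrE//; exact: ltW.
have sE : s `^ sigma = s / (s `^ e * s `^ e).
  rewrite -powRD; last by apply/implyP => _; rewrite gt_eqF.
  rewrite -{2}(powRr1 (ltW s0)) -powRN -powRD; last by apply/implyP => _; rewrite gt_eqF.
  by congr powR; rewrite /e; field.
have Z0 : 0 < r ^- n.+1 by rewrite invr_gt0 exprn_gt0.
have n1 : 1 <= n.+1%:R :> R by rewrite ler1n.
have d0 : 0 < (1 - r)^-1 by rewrite invr_gt0 subr_gt0.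
apply: (@le_trans _ _ (r ^- n.+1 * (2 * n.+1%:R * s))).
  rewrite ler_pM2l//; move: kn n1 s0; move: (_ ^+ _) (n.+1%:R : R) => y z; nra.
apply: (@le_trans _ _ (r ^- n.+1 * (2 * ((1 - r)^-1 * r ^- n.+1) * s))).
  by rewrite ler_pM2l// ler_pM2r// ler_pM2l.
apply: (@le_trans _ _ ((r * s `^ e)^-1 * (2 * ((1 - r)^-1 * (r * s `^ e)^-1) * s))).
  have := ltW Z0; have := ltW s0; have := ltW d0 => ? ? ?.
  by rewrite ler_pM ?mulr_ge0// ler_wpM2r// ler_wpM2l// ler_wpM2l.
rewrite sE le_eqVlt; apply/orP; left; apply/eqP; field.
by rewrite !gt_eqF// subr_gt0.
Qed.

Lemma le_interpolate (x a b theta : R) : 0 <= x <= a -> x <= b -> 0 < theta < 1 ->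
  x <= a `^ theta * b `^ (1 - theta).
Proof.
move=> /andP[x0 xa] xb /andP[t0 t1].
rewrite -[leLHS](powRr1 x0) -{1}(subrKC theta 1) powRD; last first.
  by rewrite subrKC oner_eq0.
have a0 := le_trans x0 xa; have b0 := le_trans x0 xb.
by apply: ler_pM; rewrite ?powR_ge0//; apply: ge0_ler_powR; rewrite ?nnegrE//; lra.
Qed.

End GeometricRates.

(** * Linear maps and complete norms on complex modules *)

Section IterLinear.
Variables (K : pzRingType) (V : lmodType K) (T : {linear V -> V}) (n : nat).

Lemma iter_is_linear : linear (iter n T).
Proof. by move=> c f g; elim: n => //= m ->; rewrite linearP. Qed.

HB.instance Definition _ :=
  GRing.isLinear.Build K V V *:%R (iter n T) iter_is_linear.

End IterLinear.

Section ComplexNorm.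
Variables (R : realType) (V : lmodType R[i]).

(** The norm is a bare function rather than part of the structure of [V], because the weak norm will
    live on the same module. *)
Record complex_norm (nrm : V -> R) : Prop := ComplexNorm {
  nrm_ge0 : forall f, 0 <= nrm f;
  nrm_eq0 : forall f, nrm f = 0 -> f = 0;
  nrmZ : forall c f, nrm (c *: f) = cabs c * nrm f;
  nrmD : forall f g, nrm (f + g) <= nrm f + nrm g }.

Definition nrm_complete (nrm : V -> R) : Prop :=
  forall u : nat -> V,
    (forall e : R, 0 < e -> exists N, forall m n,
       (N <= m)%N -> (N <= n)%N -> nrm (u m - u n) < e) ->
    exists l, forall e : R, 0 < e ->
      exists N, forall n, (N <= n)%N -> nrm (u n - l) < e.

Variable nrm : V -> R.
Hypothesis nP : complex_norm nrm.

Lemma nrm0 : nrm 0 = 0.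
Proof. by rewrite -(scale0r 0) (nrmZ nP) cabs0 mul0r. Qed.

Lemma nrmN f : nrm (- f) = nrm f.
Proof. by rewrite -scaleN1r (nrmZ nP) cabsN cabs1 mul1r. Qed.

Lemma nrmB f g : nrm (f - g) <= nrm f + nrm g.
Proof. by rewrite -(nrmN g) (nrmD nP). Qed.

Lemma nrm_distC f g : nrm (f - g) = nrm (g - f).
Proof. by rewrite -nrmN opprB. Qed.

Lemma nrm_leB f g : nrm f <= nrm g + nrm (f - g).
Proof. by rewrite -{1}(subrKC g f) (nrmD nP). Qed.

Lemma geometric_cvg (u : nat -> V) (q D : R) : nrm_complete nrm -> 0 <= q < 1 ->
  (forall n, nrm (u n.+1 - u n) <= D * q ^+ n) ->
  exists l, forall n, nrm (u n - l) <= D / (1 - q) * q ^+ n.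
Proof.
move=> cV q01 Hu; have [q0 q1] := andP q01.
have D0 : 0 <= D by have := Hu 0%N; rewrite expr0 mulr1; apply: le_trans; exact: (nrm_ge0 nP).
have q1' : 0 < 1 - q by rewrite subr_gt0.
have B0 : 0 <= D / (1 - q) by rewrite divr_ge0// ltW.
have step k n : nrm (u (n + k)%N - u n) <= D / (1 - q) * q ^+ n.
  (* Keeping the exact partial geometric sum makes the induction on [k] telescope. *)
  have : nrm (u (n + k)%N - u n) <= D / (1 - q) * (q ^+ n - q ^+ (n + k)).
    elim: k => [|k IH]; first by rewrite addn0 !subrr nrm0 mulr0.
    have := nrmD nP (u (n + k.+1)%N - u (n + k)%N) (u (n + k)%N - u n).
    rewrite subrKA => /le_trans; apply.
    rewrite addnS; apply: le_trans (lerD (Hu _) IH) _.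
    rewrite exprS le_eqVlt; apply/orP; left; apply/eqP; field.
    by rewrite gt_eqF.
  move/le_trans; apply; rewrite ler_wpM2l// gerBl exprn_ge0//.
have [|l Hl] := cV u.
  move=> e e0; have e2 : 0 < e / 2 by rewrite divr_gt0.
  have [N HN] := @geometric_small R q (D / (1 - q)) (e / 2) q01 e2.
  exists N => m n Nm Nn.
  have H k : (N <= k)%N -> nrm (u k - u N) < e / 2.
    move=> Nk; have := step (k - N)%N N; rewrite subnKC// => /le_lt_trans; apply.
    exact: HN.
  have := nrmB (u m - u N) (u n - u N); rewrite opprB addrA subrK => /le_lt_trans; apply.
  by rewrite [ltRHS](splitr e) ltrD// H.
exists l => n; apply/ler_addgt0Pr => e e0.
have [N /(_ _ (leq_addl n N)) HN] := Hl e e0.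
have := nrm_leB (u n - l) (u (n + N)%N - l) => /le_trans; apply.
rewrite addrC lerD ?(ltW HN)//.
by rewrite opprB addrA subrK nrm_distC.
Qed.

End ComplexNorm.

(** * One operator that contracts the kernel of nu: its eigenvector and the coordinate along it *)

Section RankOneSplitting.
Variables (R : realType) (V : lmodType R[i]) (nrm : V -> R).
Variables (nu : {scalar V}) (one : V) (A : R).
Hypotheses (nP : complex_norm nrm) (cV : nrm_complete nrm).
Hypotheses (A1 : 1 <= A) (nu_le : forall f, cabs (nu f) <= A * nrm f).
Hypothesis nu_one : nu one = 1.

Let nrm_ge0 f : 0 <= nrm f. Proof. exact: (nrm_ge0 nP). Qed.
Let nrmZ c f : nrm (c *: f) = cabs c * nrm f. Proof. exact: (nrmZ nP). Qed.
Let nrmD f g : nrm (f + g) <= nrm f + nrm g. Proof. exact: (nrmD nP). Qed.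
Let nuZ c f : nu (c *: f) = c * nu f. Proof. exact: linearZ. Qed.
Let nuB f g : nu (f - g) = nu f - nu g. Proof. exact: linearB. Qed.

(** Completeness of the scalars is inherited from [V]: the sequence is embedded along the line of
    [one], and its limit is read back with [nu]. *)
Lemma geometric_cvg_complex (z : nat -> R[i]) (q D : R) : 0 <= q < 1 ->
  (forall n, cabs (z n.+1 - z n) <= D * q ^+ n) ->
  exists b, forall n, cabs (z n - b) <= A * nrm one * D / (1 - q) * q ^+ n.
Proof.
move=> q01 Hz.
have [|l Hl] := @geometric_cvg R V nrm nP (fun n => z n *: one) q (nrm one * D) cV q01.
  by move=> n; rewrite -scalerBl nrmZ mulrC -mulrA ler_wpM2l.
exists (nu l) => n; have := nu_le (z n *: one - l).
rewrite nuB nuZ nu_one mulr1 => /le_trans; apply.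
have A0 : 0 <= A by apply: le_trans A1.
by rewrite -!mulrA ler_wpM2l// !mulrA.
Qed.

Variables (T : {linear V -> V}) (M e : R).
Hypotheses (M1 : 1 <= M) (T_le : forall f, nrm (T f) <= M * nrm f).
Hypothesis T_ker : forall h, nu h = 0 -> nrm (T h) <= nrm h / 4.
Hypotheses (e0 : 0 <= e) (nuT : forall f, cabs (nu (T f) - nu f) <= e * nrm f).
(** Radius of a ball preserved by the normalized map [F] below: if [nu f = 1] and [nrm f <= r], then
    [nrm (T f) <= M nrm one + (r + nrm one) / 4 <= r / 2], and the division by [nu (T f)], of
    modulus at least 15/16, does not leave the ball. *)
Let r := 5 * M * nrm one.
Hypothesis e_small : 16 * M * r * e <= 1.

Let TB f g : T (f - g) = T f - T g. Proof. exact: linearB. Qed.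
Let TZ c f : T (c *: f) = c *: T f. Proof. exact: linearZ. Qed.
Let nuT1 f : nu f = 1 -> nrm f <= r -> cabs (nu (T f) - 1) <= 1 / 16.
Proof.
move=> f1 fr; rewrite -f1; apply: le_trans (nuT f) _.
have := ler_wpM2l e0 fr; have := nrm_ge0 f.
have r0 : 0 <= r by exact: le_trans (nrm_ge0 f) fr.
have : 0 <= (M - 1) * (r * e) by apply: mulr_ge0; [rewrite subr_ge0|exact: mulr_ge0].
move: e_small; nra.
Qed.

Let cabs_near1 (z : R[i]) : cabs (z - 1) <= 1 / 16 -> 15 / 16 <= cabs z.
Proof. by move=> H; have := cabs_leB (1 : R[i]) z; rewrite cabs1 cabsB; lra. Qed.

Let near1_neq0 (z : R[i]) : 15 / 16 <= cabs z -> z != 0.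
Proof. by move=> H; apply/eqP => z0; move: H; rewrite z0 cabs0; lra. Qed.

Lemma eigenvector_unique (m : R[i]) g : T g = m *: g -> nu g = 0 -> 1 / 4 < cabs m -> g = 0.
Proof.
move=> Tg g0 m4; apply: (nrm_eq0 nP).
by have := T_ker g0; rewrite Tg nrmZ; have := nrm_ge0 g; nra.
Qed.

Let F f := (nu (T f))^-1 *: T f.

Let F_ball f : nu f = 1 -> nrm f <= r -> nu (F f) = 1 /\ nrm (F f) <= r.
Proof.
move=> f1 fr; have a15 := cabs_near1 (nuT1 f1 fr).
have a0 := near1_neq0 a15; split; first by rewrite nuZ mulVf.
rewrite nrmZ cabsV ler_pdivrMl; last by lra.
have h0 : nu (f - one) = 0 by rewrite nuB f1 nu_one subrr.
have := nrm_leB nP (T f) (T one); rewrite -TB => /le_trans; apply.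
have := T_ker h0; have := nrmB nP f one; have := T_le one.
have := nrm_ge0 one; move: a15 fr; rewrite /r.
have : nrm one <= M * nrm one by rewrite ler_peMl.
move: (nrm one) (nrm f) (nrm (T _)) (nrm (T _)) (cabs _) => x y z k a.
have : 0 <= a -> 0 <= M * x -> 15 / 16 <= a -> 15 / 16 * (5 * M * x) <= a * (5 * M * x).
  by move=> ? ? ?; apply: ler_pM => //; lra.
move=> H ? a15 ? ? ? ? ?; have := H; nra.
Qed.

(** As [f - g] lies in the kernel of [nu], its image contributes at most 16/15 times 1/4. The two
    normalizing factors differ by at most a multiple of [e * nrm (f - g)], which contributes 16/225
    by [e_small]. The sum is below 1/2. *)
Let F_contract f g : nu f = 1 -> nrm f <= r -> nu g = 1 -> nrm g <= r ->
  nrm (F f - F g) <= 1 / 2 * nrm (f - g).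
Proof.
move=> f1 fr g1 gr.
have a15 := cabs_near1 (nuT1 f1 fr); have b15 := cabs_near1 (nuT1 g1 gr).
have a0 := near1_neq0 a15; have b0 := near1_neq0 b15.
have -> : F f - F g = (nu (T f))^-1 *: T (f - g) + ((nu (T f))^-1 - (nu (T g))^-1) *: T g.
  by rewrite TB scalerBr scalerBl addrA subrK.
apply: le_trans (nrmD _ _) _; rewrite !nrmZ cabs_subV// cabsV.
have h0 : nu (f - g) = 0 by rewrite nuB f1 g1 subrr.
have d1 := T_ker h0.
have d2 : cabs (nu (T f) - nu (T g)) <= e * nrm (f - g).
  by have := nuT (f - g); rewrite h0 subr0 TB nuB.
have d3 : nrm (T g) <= M * r.
  by apply: le_trans (T_le g) _; rewrite ler_pM2l// (lt_le_trans ltr01).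
set x := nrm (f - g) in d1 d2 *; have x0 : 0 <= x by exact: nrm_ge0.
move: (cabs (nu (T f))) (cabs (nu (T g))) a15 b15 => a b a15 b15.
have ia : a^-1 <= 16 / 15 by rewrite -[leRHS]invf_div lef_pV2 ?posrE; lra.
have ib : b^-1 <= 16 / 15 by rewrite -[leRHS]invf_div lef_pV2 ?posrE; lra.
have ia0 : 0 <= a^-1 by rewrite invr_ge0; lra.
have ib0 : 0 <= b^-1 by rewrite invr_ge0; lra.
have t1 : a^-1 * nrm (T (f - g)) <= 16 / 15 * (x / 4).
  by apply: ler_pM => //; exact: nrm_ge0.
have t2 : cabs (nu (T f) - nu (T g)) / (a * b) * nrm (T g)
    <= e * x * (16 / 15 * (16 / 15)) * (M * r).
  apply: ler_pM => //; [by rewrite mulr_ge0 ?cabs_ge0// invfM mulr_ge0 | ].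
  apply: ler_pM => //; [exact: cabs_ge0|by rewrite invfM mulr_ge0|].
  by rewrite invfM; apply: ler_pM.
have : 0 <= (1 - 16 * M * r * e) * x by rewrite mulr_ge0// subr_ge0.
move: t1 t2; move: (_ * nrm (T (f - g))) (_ * nrm (T g)) => p1 p2; lra.
Qed.

Lemma exists_eigenvector :
  exists v, [/\ nu v = 1, nrm v <= r, T v = nu (T v) *: v & 15 / 16 <= cabs (nu (T v))].
Proof.
pose u n := iter n F one.
have one_r : nrm one <= r.
  have : 0 <= (M - 1) * nrm one by rewrite mulr_ge0 ?subr_ge0.
  by have := nrm_ge0 one; rewrite /r; lra.
have uP n : nu (u n) = 1 /\ nrm (u n) <= r.
  by elim: n => [//|n [IH1 IH2]]; exact: F_ball.
set D := nrm (u 1%N - u 0%N).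
have q01 : 0 <= (1 / 2 : R) < 1 by lra.
have [|l Hl] := @geometric_cvg R V nrm nP u (1 / 2) D cV q01.
  elim=> [|n IH]; first by rewrite expr0 mulr1.
  have [[? ?] [? ?]] := (uP n, uP n.+1).
  apply: le_trans (F_contract _ _ _ _) _ => //.
  by rewrite exprS mulrCA ler_wpM2l//; lra.
set c := D / (1 - 1 / 2) in Hl.
have A0 : 0 <= A by exact: le_trans A1.
have M0 : 0 <= M by exact: le_trans M1.
have l1 : nu l = 1.
  apply/eqP; rewrite -subr_eq0; apply/eqP; apply: cabs_eq0; apply/eqP.
  rewrite eq_le cabs_ge0 andbT; apply: (@le0_geometric _ (1 / 2) (A * c)) => // n.
  rewrite cabsB -(uP n).1 -nuB; apply: le_trans (nu_le _) _.
  by rewrite -mulrA; apply: ler_wpM2l; [exact: A0|exact: Hl].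
have lr : nrm l <= r.
  rewrite -subr_le0; apply: (@le0_geometric _ (1 / 2) c) => // n.
  rewrite lerBlDl; have := nrm_leB nP l (u n); rewrite nrm_distC// => /le_trans; apply.
  by rewrite lerD// (uP n).2.
exists l; split=> //; last exact/cabs_near1/nuT1.
apply/eqP; rewrite -subr_eq0; apply/eqP.
apply: (@nrm_eq0 _ _ nrm nP); apply/eqP; rewrite eq_le nrm_ge0 andbT.
(* Inserting [T (u n) = nu (T (u n)) *: u n.+1] expresses the defect of [l] through [l - u n] and
   [u n.+1 - l]. Every term is then of order [2^-n], while the left side does not depend on [n]. *)
have E n : T l - nu (T l) *: l =
    T (l - u n) + nu (T (u n)) *: (u n.+1 - l) - nu (T (l - u n)) *: l.
  have a0 : nu (T (u n)) != 0.
    by apply: near1_neq0; apply: cabs_near1; apply: nuT1; have [] := uP n.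
  have -> : T (l - u n) = T l - nu (T (u n)) *: u n.+1.
    by rewrite TB /u iterS /F scalerA divff// scale1r.
  by rewrite nuB nuZ (uP n.+1).1 mulr1 scalerBr scalerBl opprB !addrA addrNK subrK.
apply: (@le0_geometric _ (1 / 2) (M * c + 17 / 16 * c + A * M * c * r)) => // n.
rewrite (E n); apply: le_trans (nrmB nP _ _) _.
have b1 : nrm (T (l - u n)) <= M * (c * (1 / 2) ^+ n).
  by apply: le_trans (T_le _) _; rewrite ler_wpM2l// nrm_distC.
have b2 : cabs (nu (T (u n))) <= 17 / 16.
  have := cabs_leB (nu (T (u n))) 1; rewrite cabs1.
  by have := nuT1 (uP n).1 (uP n).2; lra.
have c0 : 0 <= c by have := Hl 0%N; rewrite expr0 mulr1; apply: le_trans.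
have q1 : (1 / 2) ^+ n <= 1 :> R by rewrite exprn_ile1//; lra.
have q0 : 0 <= (1 / 2) ^+ n :> R by rewrite exprn_ge0//; lra.
have b3 : nrm (u n.+1 - l) <= c * (1 / 2) ^+ n.
  by apply: le_trans (Hl _) _; rewrite ler_wpM2l// exprS ler_piMl//; lra.
rewrite mulrDl; apply: lerD; last first.
  rewrite nrmZ; apply: le_trans (ler_pM (cabs_ge0 _) (nrm_ge0 _) (nu_le _) lr) _.
  rewrite (_ : _ * _ ^+ n = A * (M * (c * (1 / 2) ^+ n)) * r); last by ring.
  by rewrite ler_wpM2r ?(le_trans _ lr)// ler_wpM2l.
apply: le_trans (nrmD _ _) _; rewrite nrmZ mulrDl; apply: lerD; first by rewrite -mulrA.
by rewrite -[leRHS]mulrA ler_pM ?cabs_ge0.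
Qed.


(* The remainder h_n of T^n f along v stays in the kernel of nu, where T
   contracts, so m^-n nu(T^n f) converges geometrically. *)
Lemma exists_coordinate v (m : R[i]) f : nu v = 1 -> nrm v <= r -> T v = m *: v ->
  15 / 16 <= cabs m <= 1 ->
  exists b, cabs (b - nu f) <= 4 * A * nrm one * (1 + A * r) * e * nrm f /\
    forall n, nrm (iter n T (f - b *: v)) <=
      (4 * A * nrm one * e * r + 1) * (1 + A * r) * nrm f * (1 / 2) ^+ n.
Proof.
move=> v1 vr Tv /andP[m15 m1].
have m0 := near1_neq0 m15.
have A0 : 0 <= A by exact: le_trans A1.
have r0 : 0 <= r by exact: le_trans vr.
pose h n := iter n T f - nu (iter n T f) *: v.
have nuh n : nu (h n) = 0 by rewrite nuB nuZ v1 mulr1 subrr.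
have Tm n : nu (T (iter n T f)) - m * nu (iter n T f) = nu (T (h n)).
  by rewrite TB TZ Tv nuB nuZ nuZ v1 mulr1 mulrC.
have hS n : h n.+1 = T (h n) - nu (T (h n)) *: v.
  rewrite -Tm /h iterS TB TZ Tv scalerBl scalerA opprB addrA; congr (_ - _).
  by rewrite [nu _ * m]mulrC subrK.
have nuTh n : cabs (nu (T (h n))) <= e * nrm (h n).
  by have := nuT (h n); rewrite nuh subr0.
have er : e * r <= 1 / 16.
  have : 0 <= (M - 1) * (r * e) by apply: mulr_ge0; [rewrite subr_ge0|exact: mulr_ge0].
  by move: e_small; lra.
(* 5/16 is the contraction factor 1/4 plus [e * r <= 1/16], the cost of projecting back to the
   kernel along [v]. *)
have h_le n : nrm (h n) <= nrm (h 0%N) * (5 / 16) ^+ n.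
  elim: n => [|n IH]; first by rewrite expr0 mulr1.
  have : nrm (h n.+1) <= 5 / 16 * nrm (h n).
    rewrite hS; apply: le_trans (nrmB nP _ _) _; rewrite nrmZ.
    have := ler_pM (cabs_ge0 _) (nrm_ge0 _) (nuTh n) vr.
    have := T_ker (nuh n).
    have := ler_wpM2r (nrm_ge0 (h n)) er; lra.
  move/le_trans; apply; rewrite exprS mulrCA; apply: ler_wpM2l => //; lra.
have h0 : nrm (h 0%N) <= (1 + A * r) * nrm f.
  apply: le_trans (nrmB nP _ _) _; rewrite nrmZ /=.
  have := ler_pM (cabs_ge0 _) (nrm_ge0 _) (nu_le f) vr; lra.
have b1_le k : ((cabs m)^-1 : R) ^+ k <= (16 / 15 : R) ^+ k.
  apply: lerXn2r; rewrite ?nnegrE ?invr_ge0 ?cabs_ge0//.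
  by rewrite -[leRHS]invf_div lef_pV2 ?posrE; lra.
have q01 : 0 <= (1 / 2 : R) < 1 by lra.
have [|b Hb] := @geometric_cvg_complex (fun n => m ^- n * nu (iter n T f))
    (1 / 2) (2 * e * nrm (h 0%N)) q01.
  move=> n; have -> : m ^- n.+1 * nu (iter n.+1 T f) - m ^- n * nu (iter n T f) =
      m ^- n.+1 * nu (T (h n)).
    by rewrite -Tm iterS exprS; field; rewrite expf_neq0.
  rewrite cabsM cabsV cabsX -exprVn.
  apply: le_trans (ler_pM _ (cabs_ge0 _) (b1_le _) (nuTh n)) _.
    by rewrite exprn_ge0// invr_ge0 cabs_ge0.
  have eh : e * nrm (h n) <= e * (nrm (h 0%N) * (5 / 16) ^+ n) by apply: ler_wpM2l.
  have g0 : 0 <= (16 / 15 : R) ^+ n.+1 by rewrite exprn_ge0//; lra.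
  apply: le_trans (ler_wpM2l g0 eh) _.
  (* The division by [m] worsens the rate 5/16 only to 1/3, still below 1/2. *)
  rewrite [leLHS](_ : _ = (16 / 15 * e * nrm (h 0%N)) * (16 / 15 * (5 / 16)) ^+ n); last first.
    by rewrite [in RHS]exprMn [in LHS]exprS; ring.
  apply: ler_pM.
  - by rewrite !mulr_ge0//; lra.
  - by rewrite exprn_ge0//; lra.
  - by have := mulr_ge0 e0 (nrm_ge0 (h 0%N)); lra.
  - by rewrite lerXn2r ?nnegrE//; lra.
have {}Hb n : cabs (m ^- n * nu (iter n T f) - b) <=
    4 * A * nrm one * e * nrm (h 0%N) * (1 / 2) ^+ n.
  by apply: le_trans (Hb n) _; rewrite le_eqVlt; apply/orP; left; apply/eqP; field.
set B := 4 * A * nrm one * e in Hb *.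
have B0 : 0 <= B by rewrite !mulr_ge0.
exists b; split=> [|n].
  have := Hb 0%N; rewrite !expr0 invr1 mul1r mulr1 cabsB => /le_trans; apply.
  rewrite (_ : _ * _ * nrm f = B * ((1 + A * r) * nrm f)); last by rewrite /B; ring.
  exact: ler_wpM2l.
have q0 : 0 <= (1 / 2 : R) ^+ n by rewrite exprn_ge0//; lra.
(* Along [v] the remainder is the error of the limit defining [b], multiplied by [m ^+ n], which is
   harmless as [cabs m <= 1]. *)
have -> : iter n T (f - b *: v) = (m ^+ n * (m ^- n * nu (iter n T f) - b)) *: v + h n.
  have Tnv : iter n T v = m ^+ n *: v.
    by elim: n {q0} => [|n IH]; rewrite ?expr0 ?scale1r// iterS IH TZ Tv scalerA exprSr.
  rewrite linearB linearZ /= Tnv /h mulrBr mulrA divff ?expf_neq0// mul1r scalerBl.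
  by rewrite scalerA [b * _]mulrC [RHS]addrC subrKA.
apply: le_trans (nrmD _ _) _; rewrite nrmZ cabsM cabsX.
have t1 : cabs m ^+ n <= 1 by rewrite exprn_ile1 ?cabs_ge0.
have t2 : cabs m ^+ n * cabs (m ^- n * nu (iter n T f) - b) * nrm v <=
    B * nrm (h 0%N) * (1 / 2) ^+ n * r.
  apply: ler_pM => //; first by rewrite mulr_ge0 ?cabs_ge0// exprn_ge0 ?cabs_ge0.
  by rewrite -[leRHS]mul1r; apply: ler_pM => //; rewrite ?cabs_ge0 ?exprn_ge0 ?cabs_ge0.
have t3 : nrm (h n) <= nrm (h 0%N) * (1 / 2) ^+ n.
  apply: le_trans (h_le n) _; apply: ler_wpM2l => //.
  by rewrite lerXn2r ?nnegrE//; lra.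
apply: le_trans (lerD t2 t3) _.
rewrite [leLHS](_ : _ = (B * r + 1) * nrm (h 0%N) * (1 / 2) ^+ n); last by ring.
apply: ler_wpM2r => //; rewrite -mulrA; apply: ler_wpM2l => //.
by rewrite addr_ge0// mulr_ge0.
Qed.

End RankOneSplitting.

(** * Families of operators that are Lipschitz only from the strong to the weak norm *)

Section ScalarFun.
Variables (K : pzRingType) (V : lmodType K) (phi : V -> K).
Hypothesis phi_scalar : scalar phi.

Lemma scalar_funB f g : phi (f - g) = phi f - phi g.
Proof. by rewrite addrC -scaleN1r phi_scalar /= mulN1r addrC. Qed.

Lemma scalar_funZ c f : phi (c *: f) = c * phi f.
Proof.
have phi0 : phi 0 = 0 by rewrite -(subrr 0) scalar_funB subrr.
by have := phi_scalar c f 0; rewrite /= phi0 !addr0.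
Qed.

End ScalarFun.

Section WeaklyLipschitzFamily.
Variables (R : realType) (V : lmodType R[i]) (nrm w : V -> R).
Variables (nu : {scalar V}) (one : V) (Q : R -> {linear V -> V}).
Variables (A kappa d0 : R).
Hypotheses (nP : complex_norm nrm) (cV : nrm_complete nrm).
Hypotheses (wD : forall f g, w (f + g) <= w f + w g)
  (wZ : forall c f, w (c *: f) = cabs c * w f).
Hypotheses (A_ge1 : 1 <= A) (kappa01 : 0 <= kappa < 1) (d0_gt0 : 0 < d0).
Hypotheses (w_le : forall f, w f <= A * nrm f) (nu_le_w : forall f, cabs (nu f) <= w f).
Hypotheses (nu_one : nu one = 1) (Q0_one : Q 0 one = one).
Hypothesis nuQ0 : forall f, nu (Q 0 f) = nu f.
Hypothesis wQ : forall t f, `|t| < d0 -> w (Q t f) <= w f.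
Hypothesis Q_lip : forall t s f, `|t| < d0 -> `|s| < d0 ->
  w (Q t f - Q s f) <= A * `|t - s| * nrm f.
Hypothesis doeblin_fortet : forall t n f, `|t| < d0 ->
  nrm (iter n (Q t) f) <= A * kappa ^+ n * nrm f + A * w f.
Hypothesis ergodic : forall n f, nu f = 0 ->
  nrm (iter n (Q 0) f) <= A * kappa ^+ n * nrm f.

Let nrm_ge0 f : 0 <= nrm f. Proof. exact: (nrm_ge0 nP). Qed.
Let nrmZ c f : nrm (c *: f) = cabs c * nrm f. Proof. exact: (nrmZ nP). Qed.
Let nrmD f g : nrm (f + g) <= nrm f + nrm g. Proof. exact: (nrmD nP). Qed.
Let nuZ c f : nu (c *: f) = c * nu f. Proof. exact: linearZ. Qed.
Let nuB f g : nu (f - g) = nu f - nu g. Proof. exact: linearB. Qed.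
Let w_ge0 f : 0 <= w f. Proof. exact: le_trans (cabs_ge0 _) (nu_le_w f). Qed.
Let A_ge0 : 0 <= A. Proof. exact: le_trans A_ge1. Qed.
Let k0 : 0 <= kappa. Proof. by case/andP: kappa01. Qed.
Let k1 : kappa <= 1. Proof. by case/andP: kappa01 => _ /ltW. Qed.
Let d00 : `|0 : R| < d0. Proof. by rewrite normr0. Qed.
Let nu_le f : cabs (nu f) <= A * nrm f. Proof. exact: le_trans (nu_le_w f) (w_le f). Qed.
Let wB f g : w (f - g) <= w f + w g.
Proof. by apply: le_trans (wD _ _) _; rewrite -scaleN1r wZ cabsN cabs1 mul1r. Qed.

Let M := A + A * A.
Let M_ge1 : 1 <= M. Proof. have := mulr_ge0 A_ge0 A_ge0; have := A_ge1. rewrite /M; lra. Qed.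
Let M_ge0 : 0 <= M. Proof. exact: le_trans M_ge1. Qed.

Lemma iter_le t n f : `|t| < d0 -> nrm (iter n (Q t) f) <= M * nrm f.
Proof.
move=> td; apply: le_trans (doeblin_fortet n f td) _; rewrite /M mulrDl -mulrA.
apply: lerD; last by rewrite -mulrA ler_wpM2l.
by rewrite ler_wpM2l// ler_piMl// exprn_ile1.
Qed.

Lemma weak_iter_le t n f : `|t| < d0 -> w (iter n (Q t) f) <= w f.
Proof. by move=> td; elim: n => //= n; apply: le_trans; exact: wQ. Qed.

(** Each step adds [Q t - Q 0] applied to [iter n (Q 0) f], whose strong norm stays below
    [M * nrm f]; the earlier error is not amplified, since [Q t] does not increase [w]. *)
Lemma weak_iter_dist t n f : `|t| < d0 ->
  w (iter n (Q t) f - iter n (Q 0) f) <= n%:R * (A * M * `|t|) * nrm f.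
Proof.
move=> td; elim: n => [|n IH].
  by rewrite subrr mul0r mul0r -(scale0r 0) wZ cabs0 mul0r.
rewrite !iterS -[Q t _](subrK (Q t (iter n (Q 0) f))) -linearB -addrA.
apply: le_trans (wD _ _) _; apply: le_trans (lerD (wQ _ td) (Q_lip _ td d00)) _.
rewrite subr0 -natr1 2!mulrDl mul1r; apply: lerD => //.
rewrite [leRHS](_ : _ = A * `|t| * (M * nrm f)); last by ring.
by apply: ler_wpM2l; [exact: mulr_ge0|exact: iter_le].
Qed.

(* Half of the iterations make the weak norm small, by ergodicity of Q 0 and
   weak closeness of Q t to Q 0; the other half upgrades this to the strong norm. *)
Lemma contraction_on_kernel : exists p delta,
  [/\ (0 < p)%N, 0 < delta, delta <= d0 & forall t h, `|t| < delta -> nu h = 0 ->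
      nrm (iter p (Q t) h) <= nrm h / 4].
Proof.
(* The factor 1/4 is shared: the terms in [kappa] get 1/8 by the choice of [m], the term in [t] gets
   1/8 by the choice of the interval. Using [m.+1] keeps [p] positive. *)
have [m Hm] := geometric_small (A * M + A * A * A) kappa01 (ltac:(lra) : 0 < (1 / 8 : R)).
pose c := A * m.+1%:R * (A * M).
have c0 : 0 <= c by rewrite /c !mulr_ge0.
exists (m.+1 + m.+1)%N, (Num.min d0 (8 * (c + 1))^-1); split=> //.
- by rewrite lt_min d0_gt0 invr_gt0; lra.
- by rewrite ge_min lexx.
move=> t h; rewrite lt_min => /andP[td tc] h0; rewrite iterD.
apply: le_trans (doeblin_fortet _ _ td) _.
have X0 : 0 <= kappa ^+ m.+1 by rewrite exprn_ge0.
have t1 := ler_wpM2l (mulr_ge0 A_ge0 X0) (iter_le m.+1 h td).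
have t2 : w (iter m.+1 (Q t) h) <=
    m.+1%:R * (A * M * `|t|) * nrm h + A * (A * kappa ^+ m.+1 * nrm h).
  rewrite -[X in w X](subrK (iter m.+1 (Q 0) h)); apply: le_trans (wD _ _) _.
  apply: lerD; first exact: weak_iter_dist.
  by apply: le_trans (w_le _) _; rewrite ler_wpM2l// ergodic.
apply: le_trans (lerD t1 (ler_wpM2l A_ge0 t2)) _.
have {}Hm := ltW (Hm m.+1 (leqnSn m)).
have ct : c * `|t| <= 1 / 8.
  have : `|t| * (8 * (c + 1)) < 1 by rewrite -ltr_pdivlMr ?mul1r//; lra.
  by have := normr_ge0 t; lra.
rewrite [leLHS](_ : _ = ((A * M + A * A * A) * kappa ^+ m.+1 + c * `|t|) * nrm h); last first.
  by rewrite /c; ring.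
by rewrite [leRHS]mulrC ler_wpM2r//; lra.
Qed.

Section IteratedContraction.
Variables (p : nat) (d1 : R).
Hypotheses (p_gt0 : (0 < p)%N) (d1_le : d1 <= d0).
Hypothesis Qp_ker : forall t h, `|t| < d1 -> nu h = 0 ->
  nrm (iter p (Q t) h) <= nrm h / 4.

(** These are the constants of [exists_coordinate] for the [p]-th power of [Q t], whose defect of
    invariance is [e = L |t|]; [K2] absorbs [e * r <= 1]. *)
Let r := 5 * M * nrm one.
Let L := p%:R * (A * M).
Let K1 := 4 * A * nrm one * (1 + A * r) * L.
Let K2 := (4 * A * nrm one + 1) * (1 + A * r).
Let r0 : 0 <= r. Proof. by rewrite /r !mulr_ge0. Qed.
Let L0 : 0 <= L. Proof. by rewrite /L !mulr_ge0. Qed.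
Let one_r : nrm one <= r.
Proof.
have : 0 <= (M - 1) * nrm one by rewrite mulr_ge0 ?subr_ge0.
by have := nrm_ge0 one; rewrite /r; lra.
Qed.

Record spectral_data (t : R) (lam : R[i]) (v : V) (phi : V -> R[i]) : Prop := SpectralData {
  sd_nu : nu v = 1;
  sd_v : nrm v <= r;
  sd_Qv : Q t v = lam *: v;
  sd_lam : cabs (lam - 1) <= A * r * `|t|;
  sd_lam1 : cabs lam <= 1;
  sd_scalar : scalar phi;
  sd_phi_v : phi v = 1;
  sd_phi_Q : forall f, phi (Q t f) = lam * phi f;
  sd_phi : forall f, cabs (phi f - nu f) <= K1 * `|t| * nrm f;
  sd_rest : forall f n, nrm (iter n (iter p (Q t)) (f - phi f *: v)) <= K2 * nrm f * (1 / 2) ^+ n }.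

Lemma exists_spectral_data t : `|t| < d1 -> 16 * M * r * L * `|t| <= 1 ->
  exists lam v phi, spectral_data t lam v phi.
Proof.
move=> td1 t_small; have td := lt_le_trans td1 d1_le.
pose e := L * `|t|; have e0 : 0 <= e by rewrite mulr_ge0.
have T_le f : nrm (iter p (Q t) f) <= M * nrm f by exact: iter_le.
have T_ker h : nu h = 0 -> nrm (iter p (Q t) h) <= nrm h / 4 by exact: Qp_ker.
have nuT f : cabs (nu (iter p (Q t) f) - nu f) <= e * nrm f.
  have <- : nu (iter p (Q 0) f) = nu f by elim: (p) => //= k <-; rewrite nuQ0.
  rewrite -nuB; apply: le_trans (nu_le_w _) _; apply: le_trans (weak_iter_dist _ _ td) _.
  by rewrite /e /L mulrA.
have e_small : 16 * M * (5 * M * nrm one) * e <= 1 by rewrite /e mulrA.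
have [v [v1 vr Tv mu15]] := exists_eigenvector nP cV A_ge1 nu_le nu_one
  M_ge1 T_le T_ker e0 nuT e_small.
set mu := nu _ in Tv mu15.
(* [Q t v - nu (Q t v) *: v] lies in the kernel of [nu] and, as [Q t] commutes with its power,
   satisfies the eigen-equation of that power for [mu]. The modulus of [mu] exceeds the contraction
   factor 1/4, so the difference vanishes. *)
have Qv : Q t v = nu (Q t v) *: v.
  apply/eqP; rewrite -subr_eq0; apply/eqP.
  apply: (eigenvector_unique nP T_ker (m := mu)).
  - rewrite linearB linearZ /= -iterSr iterS Tv linearZ /= scalerBr.
    by rewrite !scalerA mulrC.
  - by rewrite nuB nuZ v1 mulr1 subrr.
  - by lra.
set lam := nu _ in Qv.
(* [w v] is at least [cabs (nu v) = 1], hence positive, and [Q t] does not increase [w]. *)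
have lam1 : cabs lam <= 1.
  have wv : 1 <= w v by rewrite -(@cabs1 R) -v1.
  by have := wQ v td; rewrite Qv wZ -ler_pdivlMr ?divff//; lra.
have Tlam n : iter n (Q t) v = lam ^+ n *: v.
  by elim: n => [|n IH]; rewrite ?expr0 ?scale1r// iterS IH linearZ /= Qv scalerA exprSr.
have muE : mu = lam ^+ p by rewrite /mu /= Tlam nuZ v1 mulr1.
have mu1 : 15 / 16 <= cabs mu <= 1.
  by rewrite mu15 muE cabsX exprn_ile1 ?cabs_ge0.
have e1 : e * r <= 1.
  have : 0 <= (M - 1) * (r * e) by apply: mulr_ge0; [rewrite subr_ge0|exact: mulr_ge0].
  by move: e_small; rewrite -/r; have := mulr_ge0 e0 r0; lra.
have /choice[phi Hphi] : forall f, exists b, cabs (b - nu f) <= K1 * `|t| * nrm f /\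
    forall n, nrm (iter n (iter p (Q t)) (f - b *: v)) <= K2 * nrm f * (1 / 2) ^+ n.
  move=> f; have [b [Hb1 Hb2]] := exists_coordinate nP cV A_ge1 nu_le nu_one
    M_ge1 T_ker e0 nuT e_small f v1 vr Tv mu1.
  exists b; split=> [|n]; first by apply: le_trans Hb1 _; rewrite /K1 /e !mulrA.
  apply: le_trans (Hb2 n) _; rewrite /K2.
  apply: ler_wpM2r; first by rewrite exprn_ge0//; lra.
  apply: ler_wpM2r => //; apply: ler_wpM2r; first by rewrite addr_ge0// mulr_ge0.
  by rewrite lerD2r -[_ * e * _]mulrA ler_piMr// !mulr_ge0.
(* Iterates of [v] shrink by at most 15/16 per step, so they cannot decay like [2^-n]; the ratio is
   8/15. Thus [phi f] is the only scalar for which [f - phi f *: v] decays that fast, and linearity,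
   [phi v = 1] and [phi (Q t f) = lam * phi f] all follow from this uniqueness. *)
have uniq b D : (forall n, nrm (iter n (iter p (Q t)) (b *: v)) <= D * (1 / 2) ^+ n) -> b = 0.
  move=> H; apply: cabs_eq0; apply/eqP; rewrite eq_le cabs_ge0 andbT.
  have v0 : 0 < nrm v.
    by have := nu_le v; rewrite v1 cabs1; have := nrm_ge0 v; rewrite le_eqVlt => /predU1P[<-|//]; lra.
  have q01 : 0 <= (8 / 15 : R) < 1 by lra.
  rewrite -(ler_pM2r v0) mul0r; apply: (@le0_geometric _ (8 / 15) D) => // n.
  have Tn : iter n (iter p (Q t)) (b *: v) = (mu ^+ n * b) *: v.
    by rewrite -iterM mulnC linearZ /= Tlam scalerA mulrC muE exprM.
  have := H n; rewrite Tn nrmZ cabsM cabsX => Hn.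
  have c0 : 0 <= cabs b * nrm v by rewrite mulr_ge0 ?cabs_ge0.
  have : (15 / 16) ^+ n <= cabs mu ^+ n by rewrite lerXn2r ?nnegrE ?cabs_ge0//; lra.
  move/(ler_wpM2r c0); rewrite [cabs mu ^+ n * _]mulrA => /le_trans/(_ Hn).
  have -> : (1 / 2 : R) ^+ n = (15 / 16) ^+ n * (8 / 15) ^+ n.
    by rewrite -exprMn; congr (_ ^+ _); field.
  by rewrite [D * _]mulrCA ler_pM2l// exprn_gt0//; lra.
exists lam, v, phi; split=> //.
- have -> : lam - 1 = nu (Q t v - Q 0 v) by rewrite nuB nuQ0 v1.
  apply: le_trans (nu_le_w _) _; apply: le_trans (Q_lip _ td d00) _.
  by rewrite subr0 mulrAC; apply: ler_wpM2r => //; apply: ler_wpM2l.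
- move=> c f g; apply/eqP; rewrite -subr_eq0; apply/eqP.
  apply: (uniq _ (cabs c * (K2 * nrm f) + K2 * nrm g + K2 * nrm (c *: f + g))) => n.
  have -> : (phi (c *: f + g) - (c * phi f + phi g)) *: v =
    c *: (f - phi f *: v) + (g - phi g *: v) - (c *: f + g - phi (c *: f + g) *: v).
    rewrite scalerBl scalerDl scalerBr scalerA opprB [X in _ = X + _]addrACA -opprD.
    by rewrite [RHS]addrC subrKA.
  rewrite linearB linearD linearZ /=.
  apply: le_trans (nrmB nP _ _) _; rewrite mulrDl; apply: lerD; last exact: (Hphi _).2.
  apply: le_trans (nrmD _ _) _; rewrite mulrDl nrmZ; apply: lerD; last exact: (Hphi _).2.
  by rewrite -mulrA ler_wpM2l ?cabs_ge0// (Hphi _).2.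
- apply/eqP; rewrite -subr_eq0 -oppr_eq0 opprB; apply/eqP.
  apply: (uniq _ (K2 * nrm v)) => n; rewrite scalerBl scale1r; exact: (Hphi _).2.
- move=> f; apply/eqP; rewrite -subr_eq0; apply/eqP.
  apply: (uniq _ (M * (K2 * nrm f) + K2 * nrm (Q t f))) => n.
  have -> : (phi (Q t f) - lam * phi f) *: v =
    Q t (f - phi f *: v) - (Q t f - phi (Q t f) *: v).
    rewrite [Q t (_ - _)]linearB [Q t (_ *: _)]linearZ /= Qv scalerA scalerBl [phi f * _]mulrC opprB.
    by rewrite [RHS]addrC subrKA.
  rewrite linearB /=; apply: le_trans (nrmB nP _ _) _; rewrite mulrDl; apply: lerD; last exact: (Hphi _).2.
  rewrite -iterM -iterSr iterS iterM; apply: le_trans (iter_le 1 _ td) _.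
  by rewrite -mulrA ler_wpM2l// (Hphi _).2.
- by move=> f; exact: (Hphi f).1.
- by move=> f; exact: (Hphi f).2.
Qed.

Section SpectralDataTheory.
Variables (t : R) (lam : R[i]) (v : V) (phi : V -> R[i]).
Hypotheses (td : `|t| < d0) (sd : spectral_data t lam v phi).

Let phiB f g : phi (f - g) = phi f - phi g. Proof. exact: scalar_funB (sd_scalar sd) f g. Qed.
Let phiZ c f : phi (c *: f) = c * phi f. Proof. exact: scalar_funZ (sd_scalar sd) c f. Qed.

Let N f := Q t f - (lam * phi f) *: v.

Lemma phi_rest f : phi (N f) = 0.
Proof. by rewrite phiB phiZ (sd_phi_v sd) (sd_phi_Q sd) mulr1 subrr. Qed.

Lemma rest_v : N v = 0.
Proof. by rewrite /N (sd_Qv sd) (sd_phi_v sd) mulr1 subrr. Qed.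

Lemma phi_iter n f : phi (iter n (Q t) f) = lam ^+ n * phi f.
Proof. by elim: n => [|n IH]; rewrite ?mul1r//= (sd_phi_Q sd) IH exprS mulrA. Qed.

Lemma iter_v n : iter n (Q t) v = lam ^+ n *: v.
Proof.
elim: n => [|n IH]; first by rewrite expr0 scale1r.
by rewrite iterS IH linearZ /= (sd_Qv sd) scalerA exprSr.
Qed.

(** [n = 0] is excluded: there the two sides differ by [phi f *: v]. *)
Lemma iter_rest n f : (0 < n)%N ->
  iter n N f = iter n (Q t) f - (lam ^+ n * phi f) *: v.
Proof.
case: n => // n _; elim: n => [|n IH]; first by rewrite /= expr1.
rewrite iterS IH {1}/N phiB phiZ (sd_phi_v sd) phi_iter mulr1 subrr mulr0 scale0r subr0.
by rewrite linearB linearZ /= (sd_Qv sd) scalerA mulrAC -exprSr.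
Qed.

Lemma phi_bound : `|t| <= 1 -> forall f, cabs (phi f) <= (A + K1) * nrm f.
Proof.
move=> t1 f; apply: le_trans (cabs_leB _ (nu f)) _; rewrite mulrDl; apply: lerD => //.
apply: le_trans (sd_phi sd f) _; apply: ler_wpM2r => //.
by rewrite ler_piMr// /K1 !mulr_ge0// addr_ge0// mulr_ge0.
Qed.

Lemma rest_bound : `|t| <= 1 -> forall f, nrm (N f) <= (M + (A + K1) * r) * nrm f.
Proof.
move=> t1 f; apply: le_trans (nrmB nP _ _) _; rewrite mulrDl; apply: lerD.
  exact: (iter_le 1).
rewrite nrmZ cabsM [leRHS]mulrAC; apply: ler_pM (sd_v sd) => //.
  by rewrite mulr_ge0 ?cabs_ge0.
by rewrite -[leRHS]mul1r; apply: ler_pM; rewrite ?cabs_ge0 ?(sd_lam1 sd)// phi_bound.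
Qed.

Let lam_powB n : cabs (lam ^+ n - 1) <= n%:R * (A * r * `|t|).
Proof.
elim: n => [|n IH]; first by rewrite expr0 subrr cabs0 mul0r.
have -> : lam ^+ n.+1 - 1 = lam * (lam ^+ n - 1) + (lam - 1) by rewrite exprS; ring.
apply: le_trans (cabsD _ _) _; rewrite cabsM -natr1 mulrDl mul1r.
apply: lerD (sd_lam sd); apply: le_trans IH.
by rewrite -[leRHS]mul1r ler_wpM2r ?cabs_ge0 ?(sd_lam1 sd).
Qed.

Let B1 := A * M * r + 2 * A * A * r + A * r * (A * r).

(** Since [one] is fixed by [Q 0], the vector [lam^n (v - one)] is the sum of [(Q(t)^n - Q(0)^n) v],
    of [Q(0)^n (v - one)] and of [(1 - lam^n) one]. The outer terms are of order [n |t|], the middle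
    one of order [kappa^n] because [nu (v - one) = 0]. *)
Lemma weak_dist_v rho n : 0 < rho <= cabs lam -> (0 < n)%N ->
  w (v - one) <= B1 * (rho ^- n * (n%:R * `|t| + kappa ^+ n)).
Proof.
move=> /andP[rho0 rho_lam] n0.
have l0 : 0 < cabs lam := lt_le_trans rho0 rho_lam.
have lam0 : lam ^+ n != 0.
  by rewrite expf_neq0//; apply/eqP => l; move: l0; rewrite l cabs0 ltxx.
have Q0n : iter n (Q 0) one = one by elim: n {n0 lam0} => // n IH; rewrite iterS IH.
have E : v - one = (lam ^+ n)^-1 *: ((iter n (Q t) v - iter n (Q 0) v)
    + iter n (Q 0) (v - one) - (lam ^+ n - 1) *: one).
  rewrite [iter n (Q 0) (v - one)]linearB /= Q0n addrA subrK iter_v scalerBl scale1r opprB addrA subrK -scalerBr.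
  by rewrite scalerA mulVf// scale1r.
rewrite E wZ cabsV cabsX mulrCA; apply: ler_pM.
- by rewrite invr_ge0 exprn_ge0 ?cabs_ge0.
- exact: w_ge0.
- rewrite lef_pV2 ?posrE ?exprn_gt0//.
  by apply: lerXn2r => //; rewrite nnegrE; exact: ltW.
have X0 : 0 <= kappa ^+ n by rewrite exprn_ge0.
have nt0 : 0 <= n%:R * `|t| by rewrite mulr_ge0.
have t1 : w (iter n (Q t) v - iter n (Q 0) v) <= A * M * r * (n%:R * `|t|).
  apply: le_trans (weak_iter_dist n v td) _.
  rewrite [leRHS](_ : _ = n%:R * (A * M * `|t|) * r); last by ring.
  by apply: ler_wpM2l (sd_v sd); rewrite !mulr_ge0.
have t2 : w (iter n (Q 0) (v - one)) <= 2 * A * A * r * kappa ^+ n.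
  have v0 : nu (v - one) = 0 by rewrite nuB (sd_nu sd) nu_one subrr.
  apply: le_trans (w_le _) _; apply: le_trans (ler_wpM2l A_ge0 (ergodic n v0)) _.
  rewrite [leRHS](_ : _ = A * (A * kappa ^+ n * (r + r))); last by ring.
  apply: ler_wpM2l => //; apply: ler_wpM2l; first exact: mulr_ge0.
  by apply: le_trans (nrmB nP _ _) (lerD (sd_v sd) one_r).
have t3 : w ((lam ^+ n - 1) *: one) <= A * r * (A * r) * (n%:R * `|t|).
  rewrite wZ [leRHS](_ : _ = n%:R * (A * r * `|t|) * (A * r)); last by ring.
  apply: ler_pM; rewrite ?cabs_ge0 ?w_ge0//.
  by apply: le_trans (w_le _) _; rewrite ler_wpM2l.
apply: le_trans (wB _ _) _; apply: le_trans (lerD (wD _ _) t3) _.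
apply: le_trans (lerD (lerD t1 t2) (lexx _)) _.
have c1 : 0 <= A * M * r by rewrite !mulr_ge0.
have c2 : 0 <= 2 * A * A * r by rewrite !mulr_ge0.
have c3 : 0 <= A * r * (A * r) by rewrite !mulr_ge0.
rewrite /B1; move: (A * M * r) (2 * A * A * r) (A * r * (A * r)) c1 c2 c3 => x y z x0 y0 z0.
move: (n%:R * _) (kappa ^+ n) nt0 X0 => m k m0 k0'.
have := mulr_ge0 x0 k0'; have := mulr_ge0 z0 k0'; have := mulr_ge0 y0 m0; lra.
Qed.

(** Decay is known along multiples of [p]. The remaining [n %% p] steps cost a factor [M], and a
    factor 2 because [rho ^+ (n %% p)] is at least [rho ^+ p = 1 / 2]. *)
Lemma rest_one_strong rho n : 0 < rho < 1 -> rho ^+ p = 1 / 2 ->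
  nrm (iter n (Q t) (one - phi one *: v)) <= 2 * (M * (K2 * nrm one)) * rho ^+ n.
Proof.
move=> /andP[rho0 rho1] rhop; rewrite {1}(divn_eq n p) addnC iterD iterM.
apply: le_trans (iter_le _ _ td) _.
have := sd_rest sd one (n %/ p)%N; set g := _ - _ => Hg.
apply: le_trans (ler_wpM2l M_ge0 Hg) _.
rewrite [leRHS](_ : _ = M * (K2 * nrm one * (2 * rho ^+ n))); last by ring.
apply: ler_wpM2l => //; apply: ler_wpM2l.
  by rewrite /K2 !mulr_ge0// addr_ge0// !mulr_ge0.
rewrite -rhop -exprM mulnC [in leRHS](divn_eq n p) exprD mulrCA ler_peMr ?exprn_ge0 ?(ltW rho0)//.
have : rho ^+ p <= rho ^+ (n %% p) by rewrite ler_wiXn2l ?(ltW rho0) ?(ltW rho1)// ltnW// ltn_mod.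
by rewrite rhop; lra.
Qed.

(** [w] does not grow under iteration, so the smallness present at [n = 0] persists; decay in [n]
    comes from the strong bound alone. *)
Lemma rest_one_weak n : w (iter n (Q t) (one - phi one *: v)) <=
  w (v - one) + K1 * nrm one * A * r * `|t|.
Proof.
apply: le_trans (weak_iter_le _ _ td) _.
have -> : one - phi one *: v = (-1) *: (v - one) + (1 - phi one) *: v.
  by rewrite scaleN1r opprB scalerBl scale1r addrA subrK.
apply: le_trans (wD _ _) _; rewrite !wZ cabsN cabs1 mul1r; apply: lerD => //.
rewrite [leRHS](_ : _ = K1 * `|t| * nrm one * (A * r)); last by ring.
apply: ler_pM; rewrite ?cabs_ge0 ?w_ge0//.
  by rewrite cabsB -nu_one (sd_phi sd).
by apply: le_trans (w_le _) _; rewrite ler_wpM2l// (sd_v sd).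
Qed.

End SpectralDataTheory.

(** With [u = Q t v - Q s v], one has [(lam - lam') * phi' v = phi' u], and [phi' v] stays away from
    0 because [phi'] is close to [nu]. But [phi'] is bounded for the strong norm and [u] is small
    only for the weak one: hence the detour through [lam'^n phi'(u) = phi'(Q(s)^n u)] and the
    Doeblin-Fortet inequality. *)
Lemma eigenvalue_dist t s lam v phi lam' v' phi' rho n :
  `|t| < d0 -> `|s| < d0 -> `|s| <= 1 ->
  spectral_data t lam v phi -> spectral_data s lam' v' phi' ->
  K1 * `|s| * r <= 1 / 2 -> 0 < rho <= cabs lam' -> (0 < n)%N ->
  cabs (lam - lam') <= 2 * (A + K1) * (2 * A * M * r + A * A * r) *
    (rho ^- n * (n%:R * `|t - s| + kappa ^+ n)).
Proof.
move=> td sd s1 St Ss Ksmall /andP[rho0 rho_lam] n0.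
have phiB := scalar_funB (sd_scalar Ss); have phiZ := scalar_funZ (sd_scalar Ss).
pose u := Q t v - Q s v.
have E : (lam - lam') * phi' v = phi' u.
  by rewrite phiB (sd_phi_Q Ss) (sd_Qv St) phiZ mulrBl.
have phiv : 1 / 2 <= cabs (phi' v).
  have := cabs_leB (1 : R[i]) (phi' v); rewrite cabs1 cabsB -(sd_nu St).
  have := sd_phi Ss v; have := sd_v St => vr.
  have : K1 * `|s| * nrm v <= K1 * `|s| * r.
    by rewrite ler_wpM2l// /K1 !mulr_ge0// addr_ge0// mulr_ge0.
  by lra.
have K10 : 0 <= A + K1 by rewrite addr_ge0// /K1 !mulr_ge0// addr_ge0// mulr_ge0.
have X0 : 0 <= kappa ^+ n by rewrite exprn_ge0.
have nu0 : nrm u <= 2 * (M * r).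
  apply: le_trans (nrmB nP _ _) _.
  have a1 := iter_le 1 v td; have a2 := iter_le 1 v sd.
  have := ler_wpM2l M_ge0 (sd_v St); move: a1 a2 => /=; lra.
have wu : w u <= A * r * `|t - s|.
  by apply: le_trans (Q_lip _ td sd) _; rewrite mulrAC ler_wpM2r// ler_wpM2l// (sd_v St).
have l0 : 0 < cabs lam' := lt_le_trans rho0 rho_lam.
have phiu : cabs (phi' u) <=
    rho ^- n * ((A + K1) * (A * kappa ^+ n * (2 * (M * r)) + A * (A * r * `|t - s|))).
  have := phi_iter Ss n u => /(congr1 (@cabs R)); rewrite cabsM cabsX => Eu.
  have : cabs lam' ^+ n * cabs (phi' u) <=
      (A + K1) * (A * kappa ^+ n * (2 * (M * r)) + A * (A * r * `|t - s|)).
    rewrite -Eu; apply: le_trans (phi_bound Ss s1 _) _; apply: ler_wpM2l => //.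
    apply: le_trans (doeblin_fortet _ _ sd) _.
    by apply: lerD; apply: ler_wpM2l => //; rewrite mulr_ge0.
  rewrite -ler_pdivlMl ?exprn_gt0// => /le_trans; apply; apply: ler_wpM2r.
    by rewrite !mulr_ge0// addr_ge0// !mulr_ge0.
  rewrite lef_pV2 ?posrE ?exprn_gt0//.
  by apply: lerXn2r => //; rewrite nnegrE; exact: ltW.
have : cabs (lam - lam') * (1 / 2) <= cabs (phi' u).
  by rewrite -E cabsM ler_wpM2l ?cabs_ge0.
move=> H.
have ts : `|t - s| <= n%:R * `|t - s| by rewrite ler_peMl// ler1n.
have inner : A * kappa ^+ n * (2 * (M * r)) + A * (A * r * `|t - s|) <=
    (2 * A * M * r + A * A * r) * (n%:R * `|t - s| + kappa ^+ n).
  have c1 : 0 <= 2 * A * M * r by rewrite !mulr_ge0.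
  have c2 : 0 <= A * A * r by rewrite !mulr_ge0.
  have := ler_wpM2l c2 ts; have := mulr_ge0 c1 (le_trans (normr_ge0 _) ts).
  by have := mulr_ge0 c2 X0; lra.
have D0 : 0 <= rho ^- n by rewrite invr_ge0 exprn_ge0// ltW.
have := le_trans H (le_trans phiu (ler_wpM2l D0 (ler_wpM2l K10 inner))).
by lra.
Qed.

End IteratedContraction.

Theorem spectral_perturbation tau : 0 < tau < 1 ->
  exists delta, [/\ 0 < delta, delta <= d0 &
  exists (lam : R -> R[i]) (v : R -> V) (phi : R -> V -> R[i]) (N : R -> V -> V) (C rho : R),
  [/\ 0 < C, 0 <= rho < 1,
    forall t, `|t| < delta ->
    [/\ [/\ scalar (phi t), linear (N t), (forall f, cabs (phi t f) <= C * nrm f)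
          & forall f, nrm (N t f) <= C * nrm f],
        [/\ phi t (v t) = 1, (forall f, phi t (N t f) = 0), N t (v t) = 0,
            Q t (v t) = lam t *: v t & nu (v t) = 1],
        (forall n f, (0 < n)%N ->
          iter n (Q t) f = (lam t ^+ n * phi t f) *: v t + iter n (N t) f) &
        [/\ cabs (lam t - 1) <= C * `|t|, w (v t - one) <= C * `|t| `^ tau,
            cabs (phi t one - 1) <= C * `|t| `^ tau &
            forall n, (0 < n)%N -> w (iter n (N t) one) <= C * rho ^+ n * `|t| `^ tau]] &
    forall t s, `|t| < delta -> `|s| < delta ->
      cabs (lam t - lam s) <= C * `|t - s| `^ tau]].
Proof.
(* The rates are obtained with the larger exponent [sg]; interpolating with weight [th] brings it
   down to [sg * th = tau]. *)
move=> /andP[tau0 tau1]; pose sg := (1 + tau) / 2; pose th := tau / sg.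
have sg01 : 0 < sg < 1 by rewrite /sg; lra.
have [sg0 sg1] := andP sg01.
have th01 : 0 < th < 1 by rewrite divr_gt0//= ltr_pdivrMr// mul1r /sg; lra.
have powle (s : R) : 0 <= s < 1 -> s `^ sg <= s `^ tau.
  move=> /andP[]; rewrite le_eqVlt => /predU1P[<-|s0] s1.
    by rewrite !powR0// gt_eqF.
  by apply: ger_powR; rewrite ?s0 ?ltW//; rewrite /sg; lra.
have le_pow (x s : R) : 0 < x < 1 -> 0 <= s < 1 -> s <= s `^ x.
  move=> /andP[x0 x1] /andP[]; rewrite le_eqVlt => /predU1P[<-|s0] s1; first exact: powR_ge0.
  by apply: ger1_powR; rewrite ?s0 ltW.
have [q [K [/andP[kq q1] K0 Hq]]] := optimize_rate kappa01 sg01.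
have [p [d1 [p0 d10 d1d Hp]]] := contraction_on_kernel.
have [rho /andP[rho0 rho1] rhop] : exists2 x : R, 0 < x < 1 & x ^+ p = 1 / 2.
  by apply: exists_root_lt1 => //; lra.
set r := 5 * M * nrm one; set L := p%:R * (A * M).
set K1 := 4 * A * nrm one * (1 + A * r) * L.
set K2 := (4 * A * nrm one + 1) * (1 + A * r).
have n0 := nrm_ge0 one.
have r0 : 0 <= r by rewrite !mulr_ge0.
have L0 : 0 <= L by rewrite !mulr_ge0.
have K10 : 0 <= K1 by rewrite !mulr_ge0// addr_ge0// mulr_ge0.
have K20 : 0 <= K2 by rewrite mulr_ge0// addr_ge0// !mulr_ge0.
(* Each entry times [|t|] will be below 1. In turn this serves the existence of spectral data, the
   lower bound 1/2 on [phi' v] in [eigenvalue_dist], [cabs (lam t) >= q], and [|t| < 1/2], so that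
   [|t - s| < 1]. *)
have [D D1 HD] := exists_common_bound [:: 16 * M * r * L; 2 * (K1 * r); A * r / (1 - q); 2].
have D0 : 0 < D by exact: lt_le_trans ltr01 D1.
have q10 : 0 < 1 - q by rewrite subr_gt0.
pose delta := Num.min d1 D^-1.
have delta0 : 0 < delta by rewrite lt_min d10 invr_gt0.
have deltaP (t : R) : `|t| < delta -> [/\ `|t| < d1, `|t| < d0, 16 * M * r * L * `|t| <= 1,
    K1 * `|t| * r <= 1 / 2 & A * r * `|t| <= 1 - q /\ `|t| < 1 / 2].
  rewrite lt_min => /andP[td1 tD]; have td := lt_le_trans td1 d1d.
  have Dt : D * `|t| < 1 by rewrite mulrC -ltr_pdivlMr// mul1r.
  have small i : [:: 16 * M * r * L; 2 * (K1 * r); A * r / (1 - q); 2]`_i * `|t| < 1.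
    by apply: le_lt_trans Dt; exact: ler_wpM2r (HD i).
  split=> //; first exact: ltW (small 0%N).
    rewrite ler_pdivlMr// (_ : _ * 2 = 2 * (K1 * r) * `|t|); last by ring.
    exact: ltW (small 1%N).
  split; last by rewrite ltr_pdivlMr// mulrC; exact: small 3.
  rewrite -[leRHS]mul1r -ler_pdivrMr// mulrAC.
  exact: ltW (small 2).
have /choice[F HF] : forall t, exists x : R[i] * V * (V -> R[i]), `|t| < delta ->
    spectral_data p t x.1.1 x.1.2 x.2.
  move=> t; have [td|] := ltP `|t| delta; last by exists (0, 0, fun=> 0).
  have [td1 _ ts _ _] := deltaP t td.
  have [l [v [f sd]]] := exists_spectral_data d1d Hp td1 ts.
  by exists (l, v, f).
pose lam t := (F t).1.1; pose v t := (F t).1.2; pose phi t := (F t).2.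
have sd t : `|t| < delta -> spectral_data p t (lam t) (v t) (phi t) by exact: HF.
have lamq t : `|t| < delta -> 0 < q <= cabs (lam t).
  move=> td; rewrite (le_lt_trans k0 kq)/=.
  have [_ _ _ _ [rq _]] := deltaP t td.
  have := sd_lam (sd t td); have := cabs_leB (1 : R[i]) (lam t).
  by rewrite cabs1 cabsB -/M -/r; lra.
pose B1 := A * M * r + 2 * A * A * r + A * r * (A * r).
have B10 : 0 <= B1 by rewrite !addr_ge0 ?mulr_ge0.
(* Coefficients of the weak bound in [|t|^sg] and of the strong bound in [rho^n] for the remainder
   at [one]; [c6] results from interpolating them. *)
pose a0 := B1 * K + K1 * nrm one * A * r; pose b0 := A * (2 * (M * (K2 * nrm one))).
have e5 : 0 <= K1 * nrm one by exact: mulr_ge0.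
have e4 : 0 <= B1 * K by exact: mulr_ge0 B10 (ltW K0).
have e45 : 0 <= K1 * nrm one * A * r by exact: mulr_ge0 (mulr_ge0 e5 A_ge0) r0.
have a00 : 0 <= a0 by exact: addr_ge0 e4 e45.
have b00 : 0 <= b0 by exact: mulr_ge0 A_ge0 (mulr_ge0 (ler0n _ 2) (mulr_ge0 M_ge0 (mulr_ge0 K20 n0))).
pose c6 := a0 `^ th * b0 `^ (1 - th).
pose c7 := 2 * (A + K1) * (2 * A * M * r + A * A * r).
have c70 : 0 <= c7.
  by rewrite /c7; apply: mulr_ge0; [rewrite mulr_ge0// addr_ge0|rewrite addr_ge0 ?mulr_ge0].
have [C C1 HC] := exists_common_bound [:: A + K1; M + (A + K1) * r; A * r; B1 * K;
  K1 * nrm one; c6; c7 * K].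
have C0 : 0 < C by exact: lt_le_trans ltr01 C1.
have bC (c y x : R) : c <= C -> 0 <= y -> x <= c * y -> x <= C * y.
  by move=> cC y0 /le_trans; apply; rewrite ler_wpM2r.
have e3 : 0 <= A * r by rewrite mulr_ge0.
have e7 : 0 <= c7 * K by exact: mulr_ge0 c70 (ltW K0).
have half1 (t : R) : `|t| < 1 / 2 -> 0 <= `|t| < 1.
  by rewrite normr_ge0 => /lt_le_trans; apply; rewrite ler_pdivrMr// mul1r ler1n.
have wv t : `|t| < delta -> w (v t - one) <= B1 * K * `|t| `^ sg.
  move=> td; have [_ td0 _ _ [_ t1]] := deltaP t td.
  apply: Hq => //; first exact: half1.
  by move=> n n1; exact: (weak_dist_v td0 (sd t td) (lamq t td) n1).
exists delta; split=> //; first by rewrite ge_min d1d.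
exists lam, v, phi, (fun t f => Q t f - (lam t * phi t f) *: v t), C, (rho `^ (1 - th)).
have [th0 th1] := andP th01.
split=> //.
- rewrite powR_ge0/= [ltRHS](_ : _ = 1 `^ (1 - th)); last by rewrite powR1.
  by apply: gt0_ltr_powR; rewrite ?nnegrE ?subr_gt0// ltW.
- move=> t td; have [td1 td0 _ _ [_ t1]] := deltaP t td; have S := sd t td.
  have t01 := half1 t t1; have t1' : `|t| <= 1 by case/andP: t01 => _ /ltW.
  split.
  + split.
    * exact: sd_scalar S.
    * move=> c f g; rewrite linearP (sd_scalar S) /= mulrDr scalerDl scalerBr scalerA.
      by rewrite opprD addrACA mulrCA.
    * move=> f; apply: bC (HC 0%N) _ _ => //.
      exact: (phi_bound S).
    * move=> f; apply: bC (HC 1%N) _ _ => //.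
      exact: (rest_bound td0 S).
  + split; [exact: sd_phi_v S|exact: phi_rest S|exact: rest_v S|exact: sd_Qv S|exact: sd_nu S].
  + by move=> n f n1; rewrite (iter_rest S _ n1) addrC subrK.
  + split.
    * by apply: bC (HC 2) _ _ => //; exact: sd_lam S.
    * apply: bC (HC 3) _ _; first exact: powR_ge0.
      by apply: le_trans (wv t td) _; rewrite ler_wpM2l// powle.
    * apply: bC (HC 4) _ _; first exact: powR_ge0.
      rewrite -nu_one; apply: le_trans (sd_phi S one) _.
      by rewrite -/M -/r -/L -/K1 mulrAC ler_wpM2l// le_pow// tau0.
    * move=> n n1; rewrite (iter_rest S _ n1).
      have -> : iter n (Q t) one - (lam t ^+ n * phi t one) *: v t =
          iter n (Q t) (one - phi t one *: v t).
        by rewrite [iter n (Q t) (_ - _)]linearB [X in _ = _ - X]linearZ /= (iter_v S) scalerA mulrC.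
      have W1 := rest_one_weak td0 S n.
      have W2 := le_trans (w_le _) (ler_wpM2l A_ge0
        (rest_one_strong p0 td0 S n (introT andP (conj rho0 rho1)) rhop)).
      set x := w _ in W1 W2 *.
      have W3 : 0 <= x <= a0 * `|t| `^ sg.
        rewrite /x w_ge0/=; apply: le_trans W1 _; rewrite /a0 [leRHS]mulrDl; apply: lerD; first exact: wv.
        by apply: ler_wpM2l => //; exact: le_pow.
      have W4 : x <= b0 * rho ^+ n by rewrite /b0 -mulrA.
      apply: le_trans (le_interpolate W3 W4 th01) _.
      have rn0 : 0 <= rho ^+ n by rewrite exprn_ge0 ?(ltW rho0).
      rewrite (powRM _ a00 (powR_ge0 _ _)) (powRM _ b00 rn0) -powRrM.
      have -> : sg * th = tau by rewrite /th mulrC divfK// gt_eqF.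
      have -> : (rho ^+ n) `^ (1 - th) = (rho `^ (1 - th)) ^+ n.
        by rewrite powR_exprn// ltW.
      rewrite [leLHS](_ : _ = c6 * (rho `^ (1 - th)) ^+ n * `|t| `^ tau); last by rewrite /c6; ring.
      apply: ler_wpM2r; first exact: powR_ge0.
      apply: ler_wpM2r; first by rewrite exprn_ge0// powR_ge0.
      exact: (HC 5).
- move=> t s td sd'; have [_ td0 _ _ [_ t1]] := deltaP t td.
  have [_ sd0 _ sK [_ s1]] := deltaP s sd'.
  have ts : 0 <= `|t - s| < 1.
    by rewrite normr_ge0/=; apply: le_lt_trans (ler_normB _ _) _; rewrite (splitr 1) ltrD.
  apply: bC (HC 6) _ _; first exact: powR_ge0.
  apply: (@le_trans _ _ (c7 * K * `|t - s| `^ sg)); last by rewrite ler_wpM2l// powle.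
  apply: Hq => // n n1.
  apply: (eigenvalue_dist td0 sd0 _ (sd t td) (sd s sd') sK (lamq s sd') n1).
  by have /andP[_ /ltW] := half1 s s1.
Qed.

End WeaklyLipschitzFamily.

(** * A linear space of functions as a module of its own *)

Section LinearSubspace.
Variables (K : nzRingType) (F : lmodType K) (B : set F).

Definition linear_subspace : Prop :=
  [/\ B 0, forall f g, B f -> B g -> B (f + g) & forall c f, B f -> B (c *: f)].

(* The proof argument is a phantom: it lets the module structure of
   [lsubspace] be inferred from the type alone. *)
Definition lsubspace_pred of linear_subspace : {pred F} := fun f => `[< B f >].

Hypothesis hB : linear_subspace.

Lemma lsubspace_submod : submod_closed (lsubspace_pred hB).
Proof.
have [B0 BD BZ] := hB; split; first exact/asboolP.
by move=> c f g /asboolP Bf /asboolP Bg; apply/asboolP/BD => //; exact: BZ.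
Qed.

HB.instance Definition _ := GRing.isSubmodClosed.Build K F (lsubspace_pred hB) lsubspace_submod.

Definition lsubspace := {f : F | f \in lsubspace_pred hB}.
HB.instance Definition _ := SubChoice.on lsubspace.
HB.instance Definition _ := [SubChoice_isSubLmodule of lsubspace by <:].

Lemma lsubspaceP (f : lsubspace) : B (val f).
Proof. by have /asboolP := valP f. Qed.

Definition to_lsubspace f (Bf : B f) : lsubspace := exist _ f (introT (asboolP _) Bf).

End LinearSubspace.

Section FunctionSubspace.
Variables (R : realType) (E : Type) (B : set (E -> R[i])) (hB : linear_subspace B).
Implicit Types f g : lsubspace hB.

Lemma lsubspaceD f g : val (f + g) = fun x => val f x + val g x.
Proof. by []. Qed.

Lemma lsubspaceB f g : val (f - g) = fun x => val f x - val g x.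
Proof. by []. Qed.

Lemma lsubspaceZ c f : val (c *: f) = fun x => c * val f x.
Proof. by apply/funext => x; rewrite [val _]linearZ. Qed.

Lemma lsubspaceDP c f g : val (c *: f + g) = fun x => c * val f x + val g x.
Proof. by rewrite lsubspaceD lsubspaceZ. Qed.

End FunctionSubspace.

(** * Complex integrals, the weak norm and the Fourier kernels *)

Section ComplexIntegral.
Variables (R : realType) (d : measure_display) (E : measurableType d).
Implicit Types (f g : E -> R[i]) (mu : {measure set E -> \bar R}).

Lemma ReD (x y : R[i]) : complex.Re (x + y) = complex.Re x + complex.Re y.
Proof. by case: x y => [? ?] []. Qed.
Lemma ImD (x y : R[i]) : complex.Im (x + y) = complex.Im x + complex.Im y.
Proof. by case: x y => [? ?] []. Qed.
Lemma ReM (x y : R[i]) :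
  complex.Re (x * y) = complex.Re x * complex.Re y - complex.Im x * complex.Im y.
Proof. by case: x y => [? ?] []. Qed.
Lemma ImM (x y : R[i]) :
  complex.Im (x * y) = complex.Re x * complex.Im y + complex.Im x * complex.Re y.
Proof. by case: x y => [? ?] []. Qed.

Lemma Re_le_cabs (z : R[i]) : `|complex.Re z| <= cabs z.
Proof. by rewrite /cabs -sqrtr_sqr ler_wsqrtr// lerDl sqr_ge0. Qed.
Lemma Im_le_cabs (z : R[i]) : `|complex.Im z| <= cabs z.
Proof. by rewrite /cabs -sqrtr_sqr ler_wsqrtr// lerDr sqr_ge0. Qed.

Lemma cmeasurable_cabs f : cmeasurable f -> measurable_fun setT (fun x => cabs (f x)).
Proof.
move=> [mR mI]; apply: measurableT_comp.
  exact: (continuous_measurable_fun (@sqrt_continuous R)).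
by apply: measurable_funD; exact: measurable_funX.
Qed.

Lemma cmeasurableM f g : cmeasurable f -> cmeasurable g -> cmeasurable (fun x => f x * g x).
Proof.
move=> [fR fI] [gR gI]; split.
  under eq_fun do rewrite ReM.
  by apply: measurable_funB; exact: measurable_funM.
under eq_fun do rewrite ImM.
by apply: measurable_funD; exact: measurable_funM.
Qed.

Lemma cmeasurableD f g : cmeasurable f -> cmeasurable g -> cmeasurable (fun x => f x + g x).
Proof.
move=> [fR fI] [gR gI]; split.
  under eq_fun do rewrite ReD.
  exact: measurable_funD.
under eq_fun do rewrite ImD.
exact: measurable_funD.
Qed.

Lemma cmeasurable_cst (c : R[i]) : cmeasurable (fun _ : E => c).
Proof. by split; exact: measurable_cst. Qed.

Lemma cintegrable_Re mu f : cintegrable mu f ->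
  mu.-integrable setT (EFin \o (fun x => complex.Re (f x))).
Proof.
move=> [[mR mI] If]; apply: le_integrable If => //; first exact/measurable_EFinP.
by move=> x _; rewrite /= lee_fin [leRHS]ger0_norm ?cabs_ge0// Re_le_cabs.
Qed.

Lemma cintegrable_Im mu f : cintegrable mu f ->
  mu.-integrable setT (EFin \o (fun x => complex.Im (f x))).
Proof.
move=> [[mR mI] If]; apply: le_integrable If => //; first exact/measurable_EFinP.
by move=> x _; rewrite /= lee_fin [leRHS]ger0_norm ?cabs_ge0// Im_le_cabs.
Qed.

Lemma le_cintegrable mu f g : cmeasurable f -> (forall x, cabs (f x) <= cabs (g x)) ->
  cintegrable mu g -> cintegrable mu f.
Proof.
move=> mf fg [mg Ig]; split=> //; apply: le_integrable Ig => //.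
  exact/measurable_EFinP/cmeasurable_cabs.
by move=> x _; rewrite /= lee_fin !ger0_norm ?cabs_ge0.
Qed.

Lemma cintegrableZ mu (c : R[i]) f : cintegrable mu f -> cintegrable mu (fun x => c * f x).
Proof.
move=> [mf If]; split; first exact: cmeasurableM (cmeasurable_cst c) mf.
under eq_fun do rewrite cabsM EFinM.
exact: integrableZl.
Qed.

Lemma cintegrableD mu f g : cintegrable mu f -> cintegrable mu g ->
  cintegrable mu (fun x => f x + g x).
Proof.
move=> [mf If] [mg Ig]; have mfg := cmeasurableD mf mg; split=> //.
apply: le_integrable (integrableD measurableT If Ig) => //.
  exact/measurable_EFinP/cmeasurable_cabs.
move=> x _; rewrite /= lee_fin !ger0_norm ?cabs_ge0 ?addr_ge0 ?cabs_ge0//.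
exact: cabsD.
Qed.

Lemma cintD mu f g : cintegrable mu f -> cintegrable mu g ->
  cint mu (fun x => f x + g x) = cint mu f + cint mu g.
Proof.
move=> If Ig; rewrite /cint.
under eq_Rintegral do rewrite ReD.
under [X in Complex _ X = _]eq_Rintegral do rewrite ImD.
rewrite !RintegralD//; by [exact: cintegrable_Re|exact: cintegrable_Im].
Qed.

Lemma cintZ mu (c : R[i]) f : cintegrable mu f ->
  cint mu (fun x => c * f x) = c * cint mu f.
Proof.
move=> If; have IR := cintegrable_Re If; have II := cintegrable_Im If.
have Z (k : R) (h : E -> R) : mu.-integrable setT (EFin \o h) ->
  mu.-integrable setT (EFin \o (fun x => k * h x)).
  by move=> Ih; apply: (integrableZl measurableT k Ih).
rewrite /cint.
under eq_Rintegral do rewrite ReM.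
under [X in Complex _ X = _]eq_Rintegral do rewrite ImM.
rewrite RintegralB ?RintegralD ?RintegralZl//; do ?exact: Z.
by case: c.
Qed.

Lemma cintB mu f g : cintegrable mu f -> cintegrable mu g ->
  cint mu (fun x => f x - g x) = cint mu f - cint mu g.
Proof.
move=> If Ig; rewrite -[- cint mu g]mulN1r -cintZ// -cintD//; last exact: cintegrableZ.
by congr cint; apply/funext => x; rewrite mulN1r.
Qed.

Lemma absint_ge0 mu f : (0 <= absint mu f)%E.
Proof. by apply: integral_ge0 => x _; rewrite lee_fin cabs_ge0. Qed.

(* Rotate the integral onto the positive real axis and integrate real parts. *)
Lemma cabs_cint_le mu f : cintegrable mu f -> ((cabs (cint mu f))%:E <= absint mu f)%E.
Proof.
move=> If; set z := cint mu f.
have [z0|z0] := eqVneq z 0; first by rewrite z0 cabs0 absint_ge0.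
have az : 0 < cabs z.
  by rewrite lt0r cabs_ge0 andbT; apply/eqP => /cabs_eq0 /eqP; exact/negP.
pose u : R[i] := (Complex (cabs z) 0) / z.
have u1 : cabs u = 1.
  rewrite cabsM cabsV {1}/cabs /= expr0n addr0 sqrtr_sqr ger0_norm ?cabs_ge0//.
  by rewrite divff// gt_eqF.
have uz : cint mu (fun x => u * f x) = Complex (cabs z) 0 by rewrite cintZ// -/z divfK.
have Iu := cintegrableZ u If.
have -> : cabs z = \int[mu]_x complex.Re (u * f x) by move: uz => [].
have IR := cintegrable_Re Iu.
rewrite /Rintegral fineK; last exact: (integrable_fin_num measurableT IR).
rewrite /absint; apply: le_integral => //; first by case: If.
by move=> x _; rewrite lee_fin (le_trans (ler_norm _))// (le_trans (Re_le_cabs _))// cabsM u1 mul1r.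
Qed.

Lemma absint_fin mu f : cintegrable mu f -> absint mu f \is a fin_num.
Proof. by move=> [_ If]; exact: (integrable_fin_num measurableT If). Qed.

Lemma absintD mu f g : cintegrable mu f -> cintegrable mu g ->
  (absint mu (fun x => f x + g x)%R <= absint mu f + absint mu g)%E.
Proof.
move=> [mf If] [mg Ig]; rewrite /absint -ge0_integralD//; last 4 first.
- by move=> x _; rewrite lee_fin cabs_ge0.
- exact/measurable_EFinP/cmeasurable_cabs.
- by move=> x _; rewrite lee_fin cabs_ge0.
- exact/measurable_EFinP/cmeasurable_cabs.
apply: ge0_le_integral => //.
- by move=> x _; rewrite lee_fin cabs_ge0.
- exact/measurable_EFinP/cmeasurable_cabs/cmeasurableD.
- by apply: emeasurable_funD; exact/measurable_EFinP/cmeasurable_cabs.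
- by move=> x _; rewrite -EFinD lee_fin cabsD.
Qed.

Lemma absintZ mu (c : R[i]) f : cmeasurable f ->
  (absint mu (fun x => c * f x)%R = (cabs c)%:E * absint mu f)%E.
Proof.
move=> mf; rewrite /absint -ge0_integralZl//.
- by apply: eq_integral => x _; rewrite cabsM EFinM.
- exact/measurable_EFinP/cmeasurable_cabs.
- by move=> x _; rewrite lee_fin cabs_ge0.
- by rewrite lee_fin cabs_ge0.
Qed.

Lemma cabs_expi (s : R) : cabs (expi s) = 1.
Proof. by rewrite /cabs /= cos2Dsin2 sqrtr1. Qed.

Lemma expi0 : expi 0 = 1 :> R[i].
Proof. by rewrite /expi cos0 sin0. Qed.

Lemma expiD (s t : R) : expi (s + t) = expi s * expi t.
Proof.
apply/eqP; rewrite /expi cosD sinD eq_complex /=.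
by apply/andP; split; apply/eqP; ring.
Qed.

(** This transports (H3) from the base point 0 to any pair of parameters. *)
Lemma cabs_expiB (s t : R) : cabs (expi t - expi s) = cabs (expi (t - s) - 1).
Proof.
rewrite -{1}(subrKC s t) [in LHS]expiD.
by rewrite -{2}[expi s]mulr1 -mulrBr cabsM cabs_expi mul1r.
Qed.

Lemma cmeasurable_expi (h : E -> R) : measurable_fun setT h ->
  cmeasurable (fun x => expi (h x)).
Proof.
move=> mh; split => /=; apply: measurableT_comp mh.
  exact: (continuous_measurable_fun (@continuous_cos R)).
exact: (continuous_measurable_fun (@continuous_sin R)).
Qed.

(** [nu] is viewed as a constant kernel on [unit], and [Q] as a kernel ignoring the [unit]
    coordinate. The iterated integral is then an integral against their composition, a measure that
    agrees with [nu] on measurable sets. *)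
Lemma ge0_integral_invariant (Q : R.-pker E ~> E) (nu : probability E R) (g : E -> \bar R) :
  (forall A, measurable A -> nu A = (\int[nu]_x Q x A)%E) ->
  (forall x, 0 <= g x)%E -> measurable_fun setT g ->
  (\int[nu]_x \int[Q x]_y g y = \int[nu]_x g x)%E.
Proof.
move=> inv g0 mg.
pose P (_ : unit) : pprobability E R := nu.
have mP : measurable_fun [set: unit] P by exact: measurable_cst.
pose l : R.-sfker unit ~> E := kprobability mP.
pose k : R.-sfker (unit * E)%type ~> E := kernel.kernel_snd Q.
have <- := @integral_kcomp _ _ _ _ _ _ R l k tt g g0 mg.
by apply: eq_measure_integral => A mA _; rewrite [RHS](inv A mA).
Qed.

End ComplexIntegral.

Section FourierKernels.
Variables (R : realType) (d : measure_display) (E : measurableType d).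
Variables (Q : R.-pker E ~> E) (nu : probability E R) (xi : E -> R).
Hypothesis inv : forall A, measurable A -> nu A = (\int[nu]_x Q x A)%E.
Hypothesis mxi : measurable_fun setT xi.

Lemma cint_one (mu : {measure set E -> \bar R}) : mu setT = 1%E -> cint mu one_fn = 1.
Proof.
by move=> mu1; rewrite /cint /one_fn /= !Rintegral_cst// mu1 /= mul0r mulr1.
Qed.

(** Pointwise [|Q h| <= Q |h|], and integrating against the invariant [nu] removes [Q]. *)
Lemma absint_kernel_le (F h : E -> R[i]) : cmeasurable F -> cmeasurable h ->
  (forall x, cintegrable (Q x) h) -> (forall x, F x = cint (Q x) h) ->
  (absint nu F <= absint nu h)%E.
Proof.
move=> mF mh Ih FE.
have mah : measurable_fun setT (fun x => (cabs (h x))%:E).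
  exact/measurable_EFinP/cmeasurable_cabs.
have h0 x : (0 <= (cabs (h x))%:E)%E by rewrite lee_fin cabs_ge0.
rewrite [leRHS]/absint -(ge0_integral_invariant inv h0 mah).
apply: ge0_le_integral => //.
- by move=> x _; rewrite lee_fin cabs_ge0.
- exact/measurable_EFinP/cmeasurable_cabs.
- apply: measurable_fun_integral_kernel => // U mU; exact: measurable_kernel.
- by move=> x _; rewrite FE; exact: cabs_cint_le.
Qed.

Lemma cmeasurable_character (t : R) : cmeasurable (fun y => expi (t * xi y)).
Proof. by apply: cmeasurable_expi; exact: measurable_funM. Qed.

Lemma cintegrable_character (mu : {measure set E -> \bar R}) (t : R) f :
  cintegrable mu f -> cintegrable mu (fun y => expi (t * xi y) * f y).
Proof.
move=> If; apply: le_cintegrable (If).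
  by apply: cmeasurableM (cmeasurable_character t) _; case: If.
by move=> x; rewrite cabsM cabs_expi mul1r.
Qed.

Lemma Qt0 f : Qt Q xi 0 f = Qop Q f.
Proof.
apply/funext => x; rewrite /Qt /Qop; congr cint; apply/funext => y.
by rewrite mul0r expi0 mul1r.
Qed.

Lemma absint_Qt_le t f : cmeasurable f -> cmeasurable (Qt Q xi t f) ->
  (forall x, cintegrable (Q x) f) -> (absint nu (Qt Q xi t f) <= absint nu f)%E.
Proof.
move=> mf mQf If.
apply: le_trans (absint_kernel_le (h := fun y => expi (t * xi y) * f y) mQf _ _ _) _ => //.
- exact: cmeasurableM (cmeasurable_character t) mf.
- by move=> x; exact: cintegrable_character.
- rewrite /absint le_eqVlt; apply/orP; left; apply/eqP; apply: eq_integral => x _.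
  by rewrite cabsM cabs_expi mul1r.
Qed.

Lemma absint_QtB_le t s f : cmeasurable f ->
  cmeasurable (Qt Q xi t f) -> cmeasurable (Qt Q xi s f) ->
  (forall x, cintegrable (Q x) f) ->
  (absint nu (fun x => (Qt Q xi t f x - Qt Q xi s f x)%R) <=
   \int[nu]_x ((cabs (expi ((t - s) * xi x) - 1) * cabs (f x))%R)%:E)%E.
Proof.
move=> mf mt ms If.
have cM1 g : cmeasurable g -> cmeasurable (fun x : E => - g x).
  move=> mg; have := cmeasurableM (cmeasurable_cst E (-1)) mg.
  by under eq_fun do rewrite mulN1r.
have It x u := cintegrable_character u (If x).
apply: le_trans (absint_kernel_le
  (h := fun y => expi (t * xi y) * f y - expi (s * xi y) * f y) _ _ _ _) _.
- by apply: cmeasurableD => //; exact: cM1.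
- apply: cmeasurableD; first exact: cmeasurableM (cmeasurable_character t) mf.
  by apply: cM1; exact: cmeasurableM (cmeasurable_character s) mf.
- move=> x; have := cintegrableZ (-1) (It x s); under eq_fun do rewrite mulN1r.
  by move=> /(cintegrableD (It x t)).
- by move=> x; rewrite /Qt -cintB.
- rewrite /absint le_eqVlt; apply/orP; left; apply/eqP; apply: eq_integral => x _.
  by rewrite -mulrBl cabsM cabs_expiB mulrBl.
Qed.

End FourierKernels.

(** * Application to the Banach space B *)

Lemma ess_spectral_radius_ge0 (R : realType) d (E : measurableType d)
  (B : set (E -> R[i])) nrm T : 0 <= ess_spectral_radius B nrm T.
Proof.
apply: lb_le_inf; first by eexists; exists 1%N.
by move=> x [n _ <-]; exact: powR_ge0.
Qed.

Theorem theorem4p1 (R : realType) (d : measure_display) (E : measurableType d)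
  (Q : R.-pker E ~> E) (nu : probability E R) (xi : E -> R)
  (B : set (E -> R[i])) (nrm : (E -> R[i]) -> R) (a b tau : R) :
  (* Q is a transition probability with invariant probability nu *)
  (forall A, measurable A -> nu A = (\int[nu]_x Q x A)%E) ->
  (* xi measurable, nu-integrable, centered *)
  measurable_fun setT xi ->
  nu.-integrable setT (fun x => (xi x)%:E) ->
  (\int[nu]_x (xi x)%:E = 0)%E ->
  (* B is a Banach space of measurable complex functions on E *)
  banach_fun_space B nrm ->
  (* (H1) *)
  B (one_fn) ->
  (exists c : R, forall f, B f -> (absint nu f <= (c * nrm f)%:E)%E) ->
  (forall f, B f -> forall x, cintegrable (Q x) f) ->
  bounded_op B nrm (Qop Q) ->
  (exists kappa0 C : R, [/\ kappa0 < 1, 0 <= C &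
     forall n f, (1 <= n)%N -> B f ->
       nrm (fun x => iter n (Qop Q) f x - cint nu f * one_fn x)
         <= C * kappa0 ^+ n * nrm f]) ->
  (* (H3) *)
  (exists c delta : R, 0 < delta /\
     forall t : R, `|t| < delta -> forall f, B f -> nrm f <= 1 ->
       (\int[nu]_x ((cabs (expi (t * xi x) - 1) * cabs (f x))%R)%:E
          <= (c * `|t|)%:E)%E) ->
  (* (H4), with I = ]a, b[ *)
  a < 0 < b ->
  (forall t, a < t < b -> bounded_op B nrm (Qt Q xi t)) ->
  (exists kappa C : R, [/\ kappa < 1, 0 <= C,
     (forall n t f, (1 <= n)%N -> a < t < b -> B f ->
        nrm (iter n (Qt Q xi t) f)
          <= C * kappa ^+ n * nrm f + C * fine (absint nu f)) &
     (forall t, a < t < b -> ess_spectral_radius B nrm (Qt Q xi t) <= kappa)]) ->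
  0 < tau < 1 ->
  exists delta : R, [/\ 0 < delta, a <= - delta, delta <= b &
  exists (lam : R -> R[i]) (v : R -> E -> R[i]) (phi : R -> (E -> R[i]) -> R[i])
         (N : R -> (E -> R[i]) -> E -> R[i]),
    [/\ (* types of the maps on J = ]-delta, delta[ *)
        (forall t, `|t| < delta ->
           [/\ B (v t), dual_elt B nrm (phi t) & bounded_op B nrm (N t)]),
        (* the decomposition *)
        (forall t n f, `|t| < delta -> (1 <= n)%N -> B f ->
           iter n (Qt Q xi t) f
             = (fun x => lam t ^+ n * phi t f * v t x + iter n (N t) f x)),
        (* (a) *)
        (forall t, `|t| < delta ->
           [/\ phi t (v t) = 1,
               (forall f, B f -> phi t (N t f) = 0),
               N t (v t) = (fun _ => 0) &
               Qt Q xi t (v t) = (fun x => lam t * v t x)]) /\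
        (forall e : R, 0 < e -> exists eta : R, 0 < eta /\
           forall t, `|t| < delta -> 0 < `|t| < eta -> cabs (lam t - 1) < e),
        (* (b) *)
        (forall t, `|t| < delta -> cint nu (v t) = 1) /\
        (exists C rho : R, [/\ 0 < C, rho < 1 &
           forall t n, `|t| < delta -> (1 <= n)%N ->
           [/\ (absint nu (fun x => (v t x - one_fn x)%R) <= (C * `|t| `^ tau)%:E)%E,
               cabs (phi t (one_fn) - 1) <= C * `|t| `^ tau &
               (absint nu (iter n (N t) (one_fn))
                  <= (C * rho ^+ n * `|t| `^ tau)%:E)%E]]) &
        (* (c) lam is continuous on J *)
        (forall t0, `|t0| < delta -> forall e : R, 0 < e ->
           exists eta : R, 0 < eta /\
           forall t, `|t| < delta -> `|t - t0| < eta -> cabs (lam t - lam t0) < e)]].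

Proof.
move=> inv mxi _ _ hBan B1 [c0 w_le0] IQ _ [kappa0 [C0 [k01 C00 erg]]] [c3 [d3 [d30 H3]]].
move=> /andP[a0 b0] BQ [kappa [C4 [k1 C40 DF ess]]] tau01.
have [[B0 BD] BZ mB [N0 N1 NZ ND] Bcomplete] := hBan.
have hB : linear_subspace B by split.
pose V := lsubspace hB; pose nrmV (f : V) := nrm (val f).
(* [lift] is total, with value 0 outside [B], so that maps built on [V] become maps on all
   functions. *)
pose lift f : V := if pselect (B f) is left Bf then to_lsubspace hB Bf else 0.
have liftE f : B f -> val (lift f) = f by rewrite /lift; case: pselect.
have liftK (f : V) : lift (val f) = f by apply: val_inj; rewrite liftE//; exact: lsubspaceP.
have BV (f : V) : B (val f) := lsubspaceP f.
have Inu f : B f -> cintegrable nu f.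
  move=> Bf; split; first exact: mB.
  apply/integrableP; split; first exact/measurable_EFinP/cmeasurable_cabs/mB.
  apply: le_lt_trans (ltry (c0 * nrm f)); apply: le_trans (w_le0 f Bf).
  rewrite /absint le_eqVlt; apply/orP; left; apply/eqP; apply: eq_integral => x _.
  by rewrite /= ger0_norm ?cabs_ge0.
pose wV (f : V) : R := fine (absint nu (val f)).
have wE (f : V) : absint nu (val f) = (wV f)%:E by rewrite fineK// absint_fin//; exact: Inu.
have nu_linear : linear_for *%R (fun f : V => cint nu (val f)).
  move=> c f g; have If := Inu _ (BV f); have Ig := Inu _ (BV g).
  have Icf := cintegrableZ c If; rewrite lsubspaceDP.
  by rewrite (cintD Icf Ig) (cintZ c If).
pose nuV : {scalar V} := HB.pack (fun f : V => cint nu (val f))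
  (GRing.isLinear.Build _ _ _ _ (fun f : V => cint nu (val f)) nu_linear).
pose oneV : V := lift one_fn.
have oneE : val oneV = one_fn by exact: liftE.
have nuV1 : nuV oneV = 1 by rewrite /nuV /= oneE; apply: cint_one; exact: probability_setT.
have nP : complex_norm nrmV.
  split=> [f|f f0|c f|f g].
  - exact: N0.
  - by apply: val_inj; exact: N1.
  - by rewrite /nrmV lsubspaceZ NZ.
  - by rewrite /nrmV lsubspaceD; apply: ND.
have cV : nrm_complete nrmV.
  move=> u Hu; have [||l [Bl Hl]] := Bcomplete (fun n => val (u n)).
  - by move=> n; exact: BV.
  - move=> e e0; have [n Hn] := Hu e e0; exists n => m k nm nk.
    by rewrite -lsubspaceB; exact: Hn.
  exists (lift l) => e e0; have [n Hn] := Hl e e0; exists n => m nm.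
  by rewrite /nrmV lsubspaceB liftE//; exact: Hn.
have one0 : 0 < nrmV oneV.
  rewrite lt0r (nrm_ge0 nP) andbT; apply/eqP => /(nrm_eq0 nP) one0.
  by have := nuV1; rewrite one0 linear0 => /esym/eqP; rewrite oner_eq0.
have kappa_ge0 : 0 <= kappa.
  by apply: le_trans (ess 0 _); [exact: ess_spectral_radius_ge0|rewrite a0].
(* Halving [d3] keeps [t - s] in the range of (H3) for any two admissible parameters. *)
pose d0 := Num.min (Num.min (- a) b) (d3 / 2).
have d0_gt0 : 0 < d0 by rewrite !lt_min b0 oppr_gt0 a0 divr_gt0.
have d0P (t : R) : `|t| < d0 -> a < t < b /\ `|t| < d3 / 2.
  rewrite !lt_min => /andP[/andP[ta tb] t3]; split=> //.
  by move: ta; rewrite ltr_norml opprK => /andP[-> _]; exact: le_lt_trans (ler_norm t) tb.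
(* For [|t| >= d0], where [Q(t)] may not act on [B], the identity is a placeholder. *)
have /choice[QV HQV] : forall t, exists L : {linear V -> V}, `|t| < d0 ->
    forall f, val (L f) = Qt Q xi t (val f).
  move=> t; have [td|] := ltP `|t| d0; last by exists idfun.
  have [/BQ[BT TD TZ _] _] := d0P t td.
  pose g (f : V) : V := lift (Qt Q xi t (val f)).
  have gE f : val (g f) = Qt Q xi t (val f) by rewrite liftE//; exact: BT.
  have g_linear : linear g.
    move=> c u v; apply: val_inj; rewrite gE.
    by rewrite !lsubspaceDP (TD _ _ (BZ c _ (BV u)) (BV v)) (TZ _ _ (BV u)) !gE.
  pose L : {linear V -> V} := HB.pack g (GRing.isLinear.Build _ _ _ _ g g_linear).
  by exists L.
have QV_iter t n (f : V) : `|t| < d0 -> val (iter n (QV t) f) = iter n (Qt Q xi t) (val f).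
  by move=> td; elim: n => //= n <-; rewrite HQV.
have d00 : `|0 : R| < d0 by rewrite normr0.
have QV0_iter n (f : V) : val (iter n (QV 0) f) = iter n (Qop Q) (val f).
  by rewrite QV_iter//; apply: eq_iter => g; rewrite Qt0.
pose kap := Num.max (Num.max 0 kappa0) kappa.
have kap01 : 0 <= kap < 1 by rewrite !le_max lexx/= !gt_max ltr01 k01 k1.
have [kap_ge0 kap1] := andP kap01.
have kk n : kappa ^+ n <= kap ^+ n by rewrite lerXn2r ?nnegrE// le_max lexx orbT.
have erg1 n (f : V) : (0 < n)%N ->
    nrmV (iter n (QV 0) f - nuV f *: oneV) <= C0 * kappa0 ^+ n * nrmV f.
  by move=> n0; rewrite /nrmV lsubspaceB lsubspaceZ QV0_iter oneE; exact: erg.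
(* (H1) does not exclude [kappa0 < 0]; in that case its bound at [n = 1], applied to [oneV], would
   be negative unless [C0 = 0]. *)
have kk0 n : C0 * kappa0 ^+ n <= C0 * kap ^+ n.
  have [k0|k0] := leP 0 kappa0.
    by rewrite ler_wpM2l// lerXn2r ?nnegrE// !le_max lexx orbT.
  suff -> : C0 = 0 by rewrite !mul0r.
  apply/eqP; rewrite eq_le C00 andbT leNgt; apply/negP => C0p.
  have := le_trans (nrm_ge0 nP _) (erg1 1%N oneV isT); rewrite expr1 leNgt => /negP; apply.
  by rewrite pmulr_llt0// pmulr_rlt0.
have erg0 n (f : V) : (0 < n)%N ->
    nrmV (iter n (QV 0) f - nuV f *: oneV) <= C0 * kap ^+ n * nrmV f.
  move=> n0; apply: le_trans (ler_wpM2r (nrm_ge0 nP f) (kk0 n)); exact: erg1.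
(* Uniqueness of the limit: the iterates of [f] converge to [nuV f *: oneV] and, read as iterates of
   [QV 0 f], to [nuV (QV 0 f) *: oneV]. *)
have nuQ0 f : nuV (QV 0 f) = nuV f.
  apply/eqP; rewrite -subr_eq0; apply/eqP; apply: cabs_eq0; apply/eqP.
  rewrite eq_le cabs_ge0 andbT -(ler_pM2r one0) mul0r.
  apply: (@le0_geometric _ kap (C0 * kap * nrmV (QV 0 f) + C0 * kap * kap * nrmV f)) => // n.
  have := nrmB nP (iter n.+2 (QV 0) f - nuV f *: oneV)
    (iter n.+1 (QV 0) (QV 0 f) - nuV (QV 0 f) *: oneV).
  rewrite [X in nrmV X](_ : _ = (nuV (QV 0 f) - nuV f) *: oneV); last first.
    by rewrite -iterSr opprB addrC subrKA scalerBl.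
  rewrite (nrmZ nP) => /le_trans; apply.
  apply: le_trans (lerD (erg0 n.+2 f isT) (erg0 n.+1 _ isT)) _.
  by rewrite le_eqVlt; apply/orP; left; apply/eqP; rewrite !exprS; ring.
have Q01 : QV 0 oneV = oneV.
  apply: val_inj; rewrite HQV// Qt0 oneE; apply/funext => x.
  by rewrite /Qop cint_one// prob_kernel.
have [A A1 HA] := exists_common_bound [:: c0; c3; C0; C4].
have [Ac0 Ac3 AC0 AC4] : [/\ c0 <= A, c3 <= A, C0 <= A & C4 <= A].
  by split; [exact: (HA 0%N)|exact: (HA 1%N)|exact: (HA 2)|exact: (HA 3)].
have A0 : 0 <= A := le_trans ler01 A1.
have w0 f : 0 <= wV f by rewrite fine_ge0// absint_ge0.
have wD f g : wV (f + g) <= wV f + wV g.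
  by rewrite -lee_fin EFinD -!wE lsubspaceD; apply: absintD; apply: Inu.
have wZ c f : wV (c *: f) = cabs c * wV f.
  by apply: EFin_inj; rewrite EFinM -!wE lsubspaceZ absintZ//; exact: mB.
have w_le f : wV f <= A * nrmV f.
  apply: le_trans (ler_wpM2r (nrm_ge0 nP f) Ac0).
  by rewrite -lee_fin -wE; exact: w_le0.
have nu_le f : cabs (nuV f) <= wV f.
  by rewrite -lee_fin -wE; apply: cabs_cint_le; exact: Inu.
have mQt t f : `|t| < d0 -> B f -> cmeasurable (Qt Q xi t f).
  by move=> /d0P[/BQ[BT _ _ _] _] Bf; apply: mB; exact: BT.
have wQ t f : `|t| < d0 -> wV (QV t f) <= wV f.
  move=> td; rewrite -lee_fin -!wE HQV//.
  exact: (absint_Qt_le inv mxi (mB _ (BV f)) (mQt t _ td (BV f)) (IQ _ (BV f))).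
(* Homogeneity extends (H3) from the unit ball to [B]; a function of norm zero is zero and is
   treated apart. *)
have H3' t f : `|t| < d3 -> B f ->
    (\int[nu]_x ((cabs (expi (t * xi x) - 1) * cabs (f x))%R)%:E <= (c3 * `|t| * nrm f)%:E)%E.
  move=> t3 Bf; have [f0|f0] := eqVneq (nrm f) 0.
    rewrite f0 mulr0 (N1 f Bf f0) integral0_eq// => x _.
    by rewrite cabs0 mulr0.
  have fp : 0 < nrm f by rewrite lt0r f0 N0.
  pose k : R[i] := Complex (nrm f)^-1 0.
  have kE : cabs k = (nrm f)^-1.
    by rewrite /cabs /= expr0n addr0 sqrtr_sqr ger0_norm// invr_ge0 ltW.
  have := H3 t t3 (fun x => k * f x) (BZ k f Bf).
  rewrite NZ// kE mulVf// lexx => /(_ isT) Hk.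
  rewrite (_ : (_ * nrm f)%:E = ((nrm f)%:E * (c3 * `|t|)%:E)%E); last by rewrite -EFinM mulrC.
  apply: le_trans (lee_wpmul2l _ Hk); last by rewrite lee_fin ltW.
  rewrite -ge0_integralZl//; last 3 first.
  - apply/measurable_EFinP; apply: measurable_funM; apply: cmeasurable_cabs.
      by apply: cmeasurableD; [exact: cmeasurable_character|exact: cmeasurable_cst].
    exact: mB (BZ k f Bf).
  - by move=> x _; rewrite lee_fin mulr_ge0 ?cabs_ge0.
  - by rewrite lee_fin ltW.
  rewrite le_eqVlt; apply/orP; left; apply/eqP; apply: eq_integral => x _.
  by rewrite -EFinM; congr EFin; rewrite cabsM kE; field.
have Q_lip t s f : `|t| < d0 -> `|s| < d0 -> wV (QV t f - QV s f) <= A * `|t - s| * nrmV f.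
  move=> td sd; have Bf := BV f.
  have ts : `|t - s| < d3.
    by have [_ t3] := d0P t td; have [_ s3] := d0P s sd; apply: le_lt_trans (ler_normB _ _) _; rewrite (splitr d3) ltrD.
  apply: (@le_trans _ _ (c3 * `|t - s| * nrmV f)); last first.
    by rewrite ler_wpM2r ?(nrm_ge0 nP)// ler_wpM2r.
  rewrite -lee_fin -wE; apply: le_trans (H3' _ _ ts Bf).
  rewrite lsubspaceB !HQV//.
  exact: (absint_QtB_le inv mxi (mB _ Bf) (mQt t _ td Bf) (mQt s _ sd Bf) (IQ _ Bf)).
(* (H4) starts at [n = 1]; the case [n = 0] holds because [A >= 1]. *)
have doeblin_fortet t n f : `|t| < d0 ->
    nrmV (iter n (QV t) f) <= A * kap ^+ n * nrmV f + A * wV f.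
  move=> td; have nf := nrm_ge0 nP f.
  case: n => [|n].
    rewrite expr0 mulr1 /= -[leLHS]addr0 lerD// ?mulr_ge0// ler_peMl//.
  rewrite {1}/nrmV QV_iter//; have [tI _] := d0P t td.
  apply: le_trans (DF n.+1 t (val f) isT tI (BV f)) _.
  apply: lerD; last exact: (ler_wpM2r (w0 f) AC4).
  by rewrite ler_wpM2r// ler_pM// exprn_ge0.
have ergodic n f : nuV f = 0 -> nrmV (iter n (QV 0) f) <= A * kap ^+ n * nrmV f.
  move=> f0; have nf := nrm_ge0 nP f; case: n => [|n].
    by rewrite expr0 mulr1 ler_peMl.
  have := erg0 n.+1 f isT; rewrite f0 scale0r subr0 => /le_trans; apply.
  by rewrite ler_wpM2r// ler_wpM2r// exprn_ge0.
have [delta [delta0 deltad [lam [v [phi [N [C [rho [Cp /andP[rho0 rho1] P lamH]]]]]]]]] :=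
  spectral_perturbation nP cV wD wZ A1 kap01 d0_gt0 w_le nu_le nuV1 Q01 nuQ0 wQ Q_lip
    doeblin_fortet ergodic tau01.
have deltaI t : `|t| < delta -> `|t| < d0 by move=> /lt_le_trans; apply.
have deltaa : delta <= - a by apply: le_trans deltad _; rewrite !ge_min lexx.
have deltab : delta <= b by apply: le_trans deltad _; rewrite !ge_min lexx orbT.
exists delta; split=> //; first by rewrite lerNr.
exists lam, (fun t => val (v t)), (fun t f => phi t (lift f)), (fun t f => val (N t (lift f))).
have liftD f g : B f -> B g -> lift (fun x => f x + g x) = lift f + lift g.
  move=> Bf Bg; apply: val_inj; rewrite liftE; last exact: BD.
  by rewrite lsubspaceD !liftE.
have liftZ c f : B f -> lift (fun x => c * f x) = c *: lift f.
  move=> Bf; apply: val_inj; rewrite liftE; last exact: BZ.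
  by rewrite lsubspaceZ liftE.
have N_iter t n f : B f -> val (iter n (N t) (lift f)) = iter n (fun f => val (N t (lift f))) f.
  by move=> Bf; elim: n => [|n IH] /=; rewrite ?liftE// -IH liftK.
split.
- move=> t td; have [[phiS NL phiC NC] _ _ _] := P t td.
  split; first exact: BV.
  + split=> [f g Bf Bg|c f Bf|].
    * by rewrite liftD// -[lift f]scale1r phiS /= mul1r scale1r.
    * by rewrite liftZ// (scalar_funZ phiS).
    * by exists C => f Bf; have := phiC (lift f); rewrite /nrmV liftE.
  + split=> [f _|f g Bf Bg|c f Bf|].
    * exact: BV.
    * by rewrite liftD// -lsubspaceD -{1}[lift f]scale1r NL scale1r.
    * have NZ0 : N t 0 = 0.
        by have := NL (-1) 0 0; rewrite scaler0 addr0 scaleN1r addNr.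
      by rewrite liftZ// -lsubspaceZ -[c *: lift f]addr0 NL NZ0 addr0.
    * by exists C => f Bf; have := NC (lift f); rewrite /nrmV liftE.
- move=> t n f td n0 Bf; have [_ _ dec _] := P t td.
  rewrite -N_iter// -{1}(liftE f Bf) -QV_iter; last exact: deltaI.
  by rewrite (dec _ _ n0) lsubspaceDP.
- split=> [t td|e e0].
    have [_ [phiv phiN Nv Qv _] _ _] := P t td; split.
    + by rewrite liftK.
    + by move=> f Bf; rewrite liftK.
    + by rewrite liftK Nv.
    + by rewrite -HQV ?Qv ?lsubspaceZ//; exact: deltaI.
  exists (e / C); split; first exact: divr_gt0.
  move=> t td /andP[_ te]; have [_ _ _ [lamC _ _ _]] := P t td.
  by apply: le_lt_trans lamC _; rewrite mulrC -ltr_pdivlMr.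
- split=> [t td|]; first by have [_ [_ _ _ _ nuv] _ _] := P t td.
  exists C, rho; split=> // t n td n0.
  have [_ _ _ [_ Cv Cphi CN]] := P t td; split.
  + by rewrite -oneE -lsubspaceB wE lee_fin.
  + exact: Cphi.
  + by rewrite -N_iter// wE lee_fin CN.
- move=> t0 t0d e e0; have [tau0 _] := andP tau01.
  have eC : 0 < e / C by rewrite divr_gt0.
  exists ((e / C) `^ tau^-1); split; first exact: powR_gt0.
  move=> t td tt0; apply: le_lt_trans (lamH t t0 td t0d) _.
  rewrite mulrC -ltr_pdivlMr//.
  have : `|t - t0| `^ tau < ((e / C) `^ tau^-1) `^ tau.
    by apply: gt0_ltr_powR; rewrite ?nnegrE ?powR_ge0.
  by rewrite -powRrM mulVf ?gt_eqF// powRr1// ltW.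
Qed.
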